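(* Let $\mathbf{y}\in\mathrm{Im}(\Psi^\lambda_\iota)$. If $\mathbf{y}^\ast$ is extremal, then there exist $j_1,\ldots,j_l\in I$ and $\mathbf{x}\in\Sigma'_\iota[\lambda]$ such that $\mathbf{x}=\tilde{f}_{j_l}\cdots\tilde{f}_{j_1}\mathbf{y}$.
   Context: Let $\mathfrak{g}$ be the Kac-Moody algebra with generalized Cartan matrix $A=\begin{pmatrix}2&-a_1\\-a_2&2\end{pmatrix}$, $a_1,a_2\in\mathbb{Z}_{\geq1}$, $a_1a_2>4$, index set $I=\{1,2\}$, simple roots $\alpha_i$, simple coroots $\alpha_i^\vee$, fundamental weights $\Lambda_1,\Lambda_2$, Weyl group $W=\langle s_1,s_2\rangle$. Let $\iota^+=(\ldots,i_2,i_1)=(\ldots,2,1,2,1)$ and $\iota^-=(i_0,i_{-1},\ldots)=(2,1,2,1,\ldots)$, i.e. $i_k=1$ for $k$ odd and $i_k=2$ for $k$ even; $\iota=(\iota^+,\iota^-)$. Let $\lambda=k_1\Lambda_1-k_2\Lambda_2$ with $k_1,k_2\in\mathbb{Z}_{>0}$ such that: if $a_1,a_2\geq2$, either $k_2\leq k_1<(a_1-1)k_2$ or $k_1<k_2\leq(a_2-1)k_1$; if $a_1=1$, $2k_1\leq k_2\leq(a_2-2)k_1$; if $a_2=1$, $2k_2\leq k_1\leq(a_1-2)k_2$. Define integers $p_m$ by $p_0=k_2$, $p_1=k_1$, $p_{m+2}=a_2p_{m+1}-p_m$ ($m\ge0$ even), $p_{m+2}=a_1p_{m+1}-p_m$ ($m\ge0$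 odd), and for $m<0$: $p_m=a_2p_{m+1}-p_{m+2}$ ($m$ even), $p_m=a_1p_{m+1}-p_{m+2}$ ($m$ odd). Let $\alpha=\frac{a_1a_2+\sqrt{a_1^2a_2^2-4a_1a_2}}{2a_2}$, $\beta=\frac{a_1a_2+\sqrt{a_1^2a_2^2-4a_1a_2}}{2a_1}$, $\gamma_k=\alpha$ for $k$ even and $\gamma_k=\beta$ for $k$ odd. Let $\mathbb{Z}^{+\infty}_{\geq0}=\{(\ldots,x_2,x_1)\mid x_k\in\mathbb{Z}_{\ge0},\ x_k=0 \text{ for } k\gg0\}$ and $\mathbb{Z}^{-\infty}_{\leq0}=\{(x_0,x_{-1},\ldots)\mid x_k\in\mathbb{Z}_{\le0},\ x_k=0\text{ for }k\ll0\}$ with the Nakashima–Zelevinsky crystal structures associated to $\iota^\pm$, and $\mathbb{Z}_\iota(\lambda)=\mathbb{Z}^{+\infty}_{\geq0}\otimes\mathcal{T}_\lambda\otimes\mathbb{Z}^{-\infty}_{\leq0}$ (tensor product crystal; $\mathcal{T}_\lambda=\{t_\lambda\}$). There are crystal embeddings $\Psi^+_{\iota^+}:\mathcal{B}(\infty)\hookrightarrow\mathbb{Z}^{+\infty}_{\geq0}$ ($u_\infty\mapsto z_\infty=(\ldots,0,0)$), $\Psi^-_{\iota^-}:\mathcal{B}(-\infty)\hookrightarrow\mathbb{Z}^{-\infty}_{\leq0}$ ($u_{-\infty}\mapsto z_{-\infty}=(0,0,\ldots)$), and $\Psi^\lambda_\iota=\Psi^+_{\iota^+}\otimes\mathrm{id}\otimes\Psi^-_{\iota^-}:\mathcal{B}(\infty)\otimes\mathcal{T}_\lambda\otimes\mathcal{B}(-\infty)\hookrightarrow\mathbb{Z}_\iota(\lambda)$.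 The $\ast$-operation on $\mathrm{Im}(\Psi^\lambda_\iota)$ is transported from Kashiwara's $\ast$-operation; explicitly $(z_1\otimes t_\mu\otimes z_2)^\ast=z_1^\ast\otimes t_{-\mu-\mathrm{wt}(z_1)-\mathrm{wt}(z_2)}\otimes z_2^\ast$. For $\mathbf{x}=(\ldots,x_2,x_1)\otimes t_\lambda\otimes(x_0,x_{-1},\ldots)$ let $\zeta_k(\mathbf{x})=x_k$. Let $\Xi_\iota[\lambda]$ consist of $\gamma_0p_0+\gamma_0\zeta_0-\zeta_1$, $\gamma_1p_1+\zeta_0-\gamma_1\zeta_1$; for $k\ge1$: $p_k-\zeta_k$, $\gamma_k\zeta_k-\zeta_{k+1}$, $\gamma_{k+1}p_{k+1}-p_k+\zeta_k-\gamma_{k+1}\zeta_{k+1}$; for $k\le0$: $p_k+\zeta_k$, $\zeta_{k-1}-\gamma_k\zeta_k$, $\gamma_{k-1}p_{k-1}-p_k+\gamma_{k-1}\zeta_{k-1}-\zeta_k$. Set $\Sigma_\iota[\lambda]=\{\mathbf{x}\in\mathbb{Z}_\iota(\lambda)\mid\varphi(\mathbf{x})\ge0\ \forall\varphi\in\Xi_\iota[\lambda]\}$ and $\Sigma'_\iota[\lambda]=\{\hat{x}\otimes t_\lambda\otimes z_{-\infty}\in\Sigma_\iota[\lambda]\mid \hat{x}\in\mathrm{Im}(\Psi^+_{\iota^+})\}$. An element $b$ of a normal crystal is extremal if for all $w\in W$, $i\in I$: $\tilde{e}_i(S_wb)=0$ when $\langle\mathrm{wt}(S_wb),\alpha_i^\vee\rangle\ge0$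 and $\tilde{f}_i(S_wb)=0$ when $\langle\mathrm{wt}(S_wb),\alpha_i^\vee\rangle\le0$; here $S_ib=\tilde{f}_i^{n}b$ if $n=\langle\mathrm{wt}(b),\alpha_i^\vee\rangle\ge0$, $S_ib=\tilde{e}_i^{-n}b$ if $n\le0$, and $S_w=S_{j_1}\cdots S_{j_r}$ for $w=s_{j_1}\cdots s_{j_r}$. *)

(* Defs.v *)
From Stdlib Require Import Reals.
From HB Require Import structures.
From mathcomp Require Import all_boot all_order all_algebra.

Set Implicit Arguments.
Unset Strict Implicit.
Unset Printing Implicit Defensive.
Import Order.TTheory GRing.Theory Num.Theory.

Inductive Idx := I1 | I2.

Definition idx_eqb (i j : Idx) : bool :=
  match i, j with I1, I1 | I2, I2 => true | _, _ => false end.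
Lemma idx_eqP : Equality.axiom idx_eqb.
Proof. by case; case; constructor. Qed.
HB.instance Definition _ := hasDecEq.Build Idx idx_eqP.

Definition int2R (z : int) : R :=
  match z with
  | Posz n => INR n
  | Negz n => Ropp (INR n.+1)
  end.

Local Open Scope ring_scope.

Section RankTwo.
Variables a1 a2 : nat.

(* cartan i j = <alpha_i^vee, alpha_j> *)
Definition cartan (i j : Idx) : int :=
  match i, j with
  | I1, I1 => 2 | I1, I2 => - (a1%:Z) | I2, I1 => - (a2%:Z) | I2, I2 => 2
  end.

(* Weights are encoded by their pairings with the simple coroots:
   mu |-> (<mu, alpha_1^vee>, <mu, alpha_2^vee>).  Since A is nondegenerate
   (a1 a2 > 4) the weight lattice is Z Lambda_1 + Z Lambda_2, so this
   encoding is faithful. *)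
Definition weight := (int * int)%type.
Definition wpair (i : Idx) (mu : weight) : int :=
  match i with I1 => mu.1 | I2 => mu.2 end.

(* The sequence iota: position n (0-based) of the "+" part is x_{n+1},
   with i_{n+1} = 1 iff n+1 odd; position m of the "-" part is x_{-m},
   with i_{-m} = 1 iff m odd. *)
Definition iplus (n : nat) : Idx := if odd n.+1 then I1 else I2.
Definition iminus (m : nat) : Idx := if odd m then I1 else I2.

Definition sigma (ind : nat -> Idx) (s : seq int) (n : nat) : int :=
  s`_n + \sum_(n.+1 <= j < size s) cartan (ind n) (ind j) * s`_j.

(* <alpha_i^vee, wt> with wt = - sum_k x_k alpha_{i_k} *)
Definition wtc (ind : nat -> Idx) (i : Idx) (s : seq int) : int :=
  - \sum_(0 <= n < size s) s`_n * cartan i (ind n).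

(* remove trailing zeros (canonical representative of a finitely supported
   sequence) *)
Definition trim (s : seq int) : seq int :=
  rev (drop (find (fun x => x != 0) (rev s)) (rev s)).

Definition addat (s : seq int) (m : nat) (d : int) : seq int :=
  trim (set_nth 0 s m (s`_m + d)).

Definition maxl (s : seq int) : int := foldr Num.max 0 s.
Definition minl (s : seq int) : int := foldr Num.min 0 s.
Definition maxnl (s : seq nat) : nat := foldr maxn 0%N s.

Definition sig_p (i : Idx) (s : seq int) : int :=
  maxl [seq sigma iplus s n | n <- iota 0 (size s) & iplus n == i].

Definition eps_p (i : Idx) (s : seq int) : int := sig_p i s.

Definition f_p (i : Idx) (s : seq int) : seq int :=
  let c := sig_p i s in
  let m := find (fun n => (iplus n == i) && (sigma iplus s n == c))
                (iota 0 (size s + 2)) in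
  addat s m 1.

Definition e_p (i : Idx) (s : seq int) : option (seq int) :=
  let c := sig_p i s in
  if 0 < c then
    let m := maxnl [seq n <- iota 0 (size s) |
                    (iplus n == i) && (sigma iplus s n == c)] in
    Some (addat s m (-1))
  else None.

Definition sig_m (i : Idx) (t : seq int) : int :=
  minl [seq sigma iminus t n | n <- iota 0 (size t) & iminus n == i].

Definition phi_m (i : Idx) (t : seq int) : int := - sig_m i t.
Definition eps_m (i : Idx) (t : seq int) : int := phi_m i t - wtc iminus i t.

(* f acts at the minimal k = -m in M^(i), i.e. the maximal position m *)
Definition f_m (i : Idx) (t : seq int) : option (seq int) :=
  let c := sig_m i t in
  if c < 0 then
    let m := maxnl [seq n <- iota 0 (size t) |
                    (iminus n == i) && (sigma iminus t n == c)] in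
    Some (addat t m 1)
  else None.

(* e acts at the maximal k = -m in M^(i), i.e. the minimal position m *)
Definition e_m (i : Idx) (t : seq int) : option (seq int) :=
  let c := sig_m i t in
  let m := find (fun n => (iminus n == i) && (sigma iminus t n == c))
                (iota 0 (size t + 2)) in
  Some (addat t m (-1)).

(* ---------------- Z_iota(mu) = Z^{+infty} (x) T_mu (x) Z^{-infty} -------- *)
Record elt := Elt { zp : seq int; zmu : weight; zm : seq int }.

Definition wt (i : Idx) (x : elt) : int :=
  wtc iplus i (zp x) + wpair i (zmu x) + wtc iminus i (zm x).

(* phi_i of the left factor  zp x (x) t_mu *)
Definition phiL (i : Idx) (x : elt) : int :=
  eps_p i (zp x) + wtc iplus i (zp x) + wpair i (zmu x).

(* Kashiwara's tensor product rule *)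
Definition ft (i : Idx) (x : elt) : option elt :=
  if eps_m i (zm x) < phiL i x then Some (Elt (f_p i (zp x)) (zmu x) (zm x))
  else omap (fun t => Elt (zp x) (zmu x) t) (f_m i (zm x)).

Definition et (i : Idx) (x : elt) : option elt :=
  if eps_m i (zm x) <= phiL i x then
    omap (fun s => Elt s (zmu x) (zm x)) (e_p i (zp x))
  else omap (fun t => Elt (zp x) (zmu x) t) (e_m i (zm x)).

Fixpoint iter_opt {T : Type} (n : nat) (g : T -> option T) (x : T) : option T :=
  match n with
  | 0%N => Some x
  | n'.+1 => obind g (iter_opt n' g x)
  end.

Definition S_i (i : Idx) (x : elt) : option elt :=
  let n := wt i x in
  if 0 <= n then iter_opt (absz n) (ft i) x else iter_opt (absz n) (et i) x.

(* S_w for w = s_{j_1} ... s_{j_r}, given as the word [:: j_1; ...; j_r] *)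
Definition S_w (w : seq Idx) (x : elt) : option elt :=
  foldr (fun j ox => obind (S_i j) ox) (Some x) w.

(* extremal element (quantifying over all words in I, which covers all w in W) *)
Definition extremal (x : elt) : Prop :=
  forall (w : seq Idx) (i : Idx) (y : elt), S_w w x = Some y ->
    (0 <= wt i y -> et i y = None) /\ (wt i y <= 0 -> ft i y = None).

Definition f_word (js : seq Idx) (x : elt) : option elt :=
  foldl (fun ox j => obind (ft j) ox) (Some x) js.

(* Im Psi^+ = crystal generated by z_infty = (...,0,0) under the f_i *)
Definition ImP (s : seq int) : Prop :=
  exists js : seq Idx, s = foldl (fun s j => f_p j s) [::] js.

(* Im Psi^- = crystal generated by z_{-infty} = (0,0,...) under the e_i *)
Definition ImM (t : seq int) : Prop :=
  exists js : seq Idx,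
    Some t = foldl (fun ot j => obind (e_m j) ot) (Some [::]) js.

Definition ImPsi (lam : weight) (x : elt) : Prop :=
  zmu x = lam /\ ImP (zp x) /\ ImM (zm x).

(* On Im Psi^+ :  Psi(b^* ) = (..., c_2, c_1) where c_1 = eps_{i_1}(b),
   b_1 = e_{i_1}^{c_1} b, c_2 = eps_{i_2}(b_1), ...  (greedy e-stripping
   along iota^+, the transport of Kashiwara's * through the Kashiwara
   embeddings defining Psi^+). *)
Definition hgt (s : seq int) : nat := \sum_(0 <= n < size s) (absz (nth (0:int) s n)).

Fixpoint st_p (s : seq int) (n : nat) : seq int :=
  match n with
  | 0%N => s
  | n'.+1 => let s' := st_p s n' in
             let i := iplus n' in
             odflt s' (iter_opt (absz (eps_p i s')) (e_p i) s')
  end.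

Definition star_p (s : seq int) : seq int :=
  trim [seq eps_p (iplus n) (st_p s n) | n <- iota 0 (2 * hgt s + 2)].

(* On Im Psi^- :  Psi(b^* ) = (-c_0, -c_{-1}, ...) where c_0 = phi_{i_0}(b),
   b_1 = f_{i_0}^{c_0} b, c_{-1} = phi_{i_{-1}}(b_1), ... *)
Fixpoint st_m (t : seq int) (n : nat) : seq int :=
  match n with
  | 0%N => t
  | n'.+1 => let t' := st_m t n' in
             let i := iminus n' in
             odflt t' (iter_opt (absz (phi_m i t')) (f_m i) t')
  end.

Definition star_m (t : seq int) : seq int :=
  trim [seq - phi_m (iminus n) (st_m t n) | n <- iota 0 (2 * hgt t + 2)].

Definition star (x : elt) : elt :=
  Elt (star_p (zp x))
      (- (zmu x).1 - wtc iplus I1 (zp x) - wtc iminus I1 (zm x),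
       - (zmu x).2 - wtc iplus I2 (zp x) - wtc iminus I2 (zm x))
      (star_m (zm x)).

Variables k1 k2 : nat.

(* ppair n = (p_n, p_{n+1}) *)
Fixpoint ppair (n : nat) : int * int :=
  match n with
  | 0%N => (k2%:Z, k1%:Z)
  | n'.+1 => let: (x, y) := ppair n' in
             (y, (if odd n' then a1%:Z else a2%:Z) * y - x)
  end.

(* qpair n = (p_{-n}, p_{-n+1}) *)
Fixpoint qpair (n : nat) : int * int :=
  match n with
  | 0%N => (k2%:Z, k1%:Z)
  | n'.+1 => let: (x, y) := qpair n' in
             ((if odd n then a1%:Z else a2%:Z) * x - y, x)
  end.

Definition p (k : int) : int :=
  match k with
  | Posz n => (ppair n).1
  | Negz n => (qpair n.+1).1
  end.

Definition zeta (x : elt) (k : int) : int :=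
  match k with
  | Posz n.+1 => (zp x)`_n
  | Posz 0 => (zm x)`_0
  | Negz n => (zm x)`_n.+1
  end.

Definition succz (k : int) : int := k + 1.
Definition predz (k : int) : int := k - 1.

Local Close Scope ring_scope.
Local Open Scope R_scope.

Definition alphaR : R :=
  ((INR a1 * INR a2 + sqrt (INR a1 ^ 2 * INR a2 ^ 2 - 4 * INR a1 * INR a2))
     / (2 * INR a2)).
Definition betaR : R :=
  ((INR a1 * INR a2 + sqrt (INR a1 ^ 2 * INR a2 ^ 2 - 4 * INR a1 * INR a2))
     / (2 * INR a1)).

Definition gam (k : int) : R := if odd (absz k) then betaR else alphaR.

Definition zR (x : elt) (k : int) : R := int2R (zeta x k).
Definition pR (k : int) : R := int2R (p k).

Definition Sigma (lam : weight) (x : elt) : Prop :=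
  zmu x = lam /\
  (0 <= gam (Posz 0) * pR (Posz 0) + gam (Posz 0) * zR x (Posz 0) - zR x (Posz 1)) /\
  (0 <= gam (Posz 1) * pR (Posz 1) + zR x (Posz 0) - gam (Posz 1) * zR x (Posz 1)) /\
  (forall k : int, (Posz 1 <= k)%O ->
     (0 <= pR k - zR x k) /\
     (0 <= gam k * zR x k - zR x (succz k)) /\
     (0 <= gam (succz k) * pR (succz k) - pR k + zR x k
             - gam (succz k) * zR x (succz k))) /\
  (forall k : int, (k <= Posz 0)%O ->
     (0 <= pR k + zR x k) /\
     (0 <= zR x (predz k) - gam k * zR x k) /\
     (0 <= gam (predz k) * pR (predz k) - pR k + gam (predz k) * zR x (predz k)
             - zR x k)).

Definition Sigma' (lam : weight) (x : elt) : Prop :=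
  Sigma lam x /\ zm x = [::] /\ ImP (zp x).

Local Close Scope R_scope.
Local Open Scope ring_scope.
End RankTwo.

Definition admissible (a1 a2 k1 k2 : nat) : Prop :=
  (0 < a1)%N /\ (0 < a2)%N /\ (4 < a1 * a2)%N /\ (0 < k1)%N /\ (0 < k2)%N /\
  ((2 <= a1)%N -> (2 <= a2)%N ->
     ((k2 <= k1)%N /\ (k1 < (a1 - 1) * k2)%N) \/
     ((k1 < k2)%N /\ (k2 <= (a2 - 1) * k1)%N)) /\
  (a1 = 1%N -> (2 * k1 <= k2)%N /\ (k2 <= (a2 - 2) * k1)%N) /\
  (a2 = 1%N -> (2 * k2 <= k1)%N /\ (k1 <= (a1 - 2) * k2)%N).

(* Main.v *)
Require Import Defs.
From Stdlib Require Import Reals Lra.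
From HB Require Import structures.
From mathcomp Require Import all_boot all_order all_algebra.
From mathcomp Require Import zify ssrZ.

(** Up to trailing zeros an element of the Nakashima-Zelevinsky crystal is a
    list, and prepending an entry is tensoring with an elementary crystal [B_i].
    Hence the string of [x :: s] is computed from that of [s], and this recursion
    shows that the relation [c is the string of b] is symmetric: the greedy
    description of the star operation is an involution.

    Strings satisfy the rank two cone inequalities
    [K_(n+1) c_n >= K'_n c_(n+1)], which are preserved by all crystal operators.
    If [y^*] is extremal, the reflections [S_i] applied to [y^*] move the boundary
    between the two tensor factors of [y] one step to the left or to the right,
    replacing the crossed coordinate [x_k] by [x_k - p_k] or [x_k + p_k].  The
    cone inequalities hold after every number of steps, that is, for every
    position of the boundary; as [K_(n+1) / K'_n] tends to [gamma], they yield in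
    the limit all the inequalities defining [Sigma].

    In the coordinates [U_k = x_k] ([k >= 1]), [U_k = p_k + x_k] ([k <= 0]) the
    operator [f_i] increments [U_k] at the leftmost maximum, so that
    [U_(k-2) + U_k < a U_(k-1)], and this preserves the limit inequalities because
    [gamma_k + 1 / gamma_(k-1)] is [a_1] or [a_2].  Finally, applying [f_i]
    repeatedly consumes the right factor. *)

Set Implicit Arguments.
Unset Strict Implicit.
Unset Printing Implicit Defensive.
Import Order.TTheory GRing.Theory Num.Theory.
Local Open Scope ring_scope.

Definition other (i : Idx) : Idx := if i is I1 then I2 else I1.

Lemma otherK : involutive other.
Proof. by case. Qed.

Lemma neq_other (i j : Idx) : (i == other j) = (i != j).
Proof. by case: i; case: j. Qed.

(** * Finitely supported sequences up to trailing zeros *)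

(** The operators of the statement return trimmed lists, the recursive ones below do not; hence
    comparison up to trailing zeros. *)
Definition teq (s s' : seq int) : Prop := trim s = trim s'.

Lemma trim_nil : trim [::] = [::].
Proof. by []. Qed.

Lemma trim_cons (x : int) (s : seq int) :
  trim (x :: s) = if (x == 0) && (trim s == [::]) then [::] else x :: trim s.
Proof.
rewrite /trim rev_cons; set r := rev s.
have -> : (rev (drop (find (fun x => x != 0) r) r) == [::]) = ~~ has (fun x => x != 0) r.
  rewrite -size_eq0 size_rev size_drop subn_eq0 has_find -leqNgt.
  by [].
rewrite -cats1 find_cat /=.
case: ifP => hr /=.
  rewrite andbF drop_cat; move: (hr); rewrite has_find => ->.
  by rewrite rev_cat /=.
rewrite andbT; case: (x =P 0) => [->|_] /=.
  by rewrite drop_oversize // size_cat /=.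
rewrite addn0 drop_size_cat // (@drop_oversize _ _ r) //.
by rewrite leqNgt -has_find hr.
Qed.

Lemma nth_trim (s : seq int) n : (trim s)`_n = s`_n.
Proof.
elim: s n => [|x s IH] n; first by [].
rewrite trim_cons; case: ifP => [/andP[/eqP-> /eqP e]|_]; last by case: n => /=.
by case: n => [//|n] /=; rewrite -IH e nth_nil.
Qed.

Lemma trimK (s : seq int) : trim (trim s) = trim s.
Proof.
elim: s => [//|x s IH]; rewrite trim_cons; case: ifP => // h.
by rewrite trim_cons IH h.
Qed.

Lemma trim_eq0 (s : seq int) : (forall n, s`_n = 0) -> trim s = [::].
Proof.
elim: s => [//|x s IH] h; rewrite trim_cons IH => [|n]; last exact: (h n.+1).
by rewrite (h 0%N : x = 0) !eqxx.
Qed.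

Lemma teqP (s s' : seq int) : (forall n, s`_n = s'`_n) <-> teq s s'.
Proof.
split=> [|h n]; last by rewrite -(nth_trim s) -(nth_trim s') h.
rewrite /teq; elim: s s' => [|x s IH] [|y s'] h //=.
- by rewrite trim_nil [RHS]trim_eq0 // => n; rewrite -h nth_nil.
- by rewrite trim_nil [LHS]trim_eq0 // => n; rewrite h nth_nil.
by rewrite !trim_cons (IH s') => [|n]; [rewrite (h 0%N : x = y) | exact: (h n.+1)].
Qed.

Lemma teq_trim (s : seq int) : teq (trim s) s.
Proof. exact: trimK. Qed.

Lemma teq_cons (x : int) (s s' : seq int) : teq s s' -> teq (x :: s) (x :: s').
Proof. by rewrite /teq !trim_cons => ->. Qed.

Lemma trim_map_opp (s : seq int) :
  trim [seq - x | x <- s] = [seq - x | x <- trim s].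
Proof.
elim: s => [//|x s IH] /=; rewrite !trim_cons IH oppr_eq0.
by case: (trim s) => [|y r] /=; case: (x == 0).
Qed.

(** * Passing from integers to real numbers *)

Lemma int2R_IZR z : int2R z = IZR (Z_of_int z).
Proof.
case: z => n; first exact: INR_IZR_INZ.
by rewrite /int2R INR_IZR_INZ -opp_IZR; congr IZR; lia.
Qed.

Lemma int2R1 : int2R 1 = IZR 1.
Proof. by []. Qed.

Lemma int2RD x y : int2R (x + y) = Rplus (int2R x) (int2R y).
Proof. by rewrite !int2R_IZR -plus_IZR; congr IZR; lia. Qed.

Lemma int2RB x y : int2R (x - y) = Rminus (int2R x) (int2R y).
Proof. by rewrite !int2R_IZR -minus_IZR; congr IZR; lia. Qed.

Lemma int2RM x y : int2R (x * y) = Rmult (int2R x) (int2R y).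
Proof. by rewrite !int2R_IZR -mult_IZR; congr IZR; lia. Qed.

Lemma int2R_le x y : x <= y -> Rle (int2R x) (int2R y).
Proof. by move=> h; rewrite !int2R_IZR; apply: IZR_le; lia. Qed.

Lemma int2R_ge0 x : Rle 0 (int2R x) -> 0 <= x.
Proof. by rewrite int2R_IZR => /le_IZR h; lia. Qed.

Section Crystal.
Variables a1 a2 : nat.
Local Notation cartan := (cartan a1 a2).

Lemma cartan_diag (i : Idx) : cartan i i = 2.
Proof. by case: i. Qed.

(** * Recursive form of the Nakashima-Zelevinsky crystal *)

(* In all the definitions below [j] is the letter attached to the first entry
   of [s], the letters of the following entries alternating. *)
Fixpoint wgt (i j : Idx) (s : seq int) : int :=
  if s is x :: s' then wgt i (other j) s' - x * cartan i j else 0.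

Fixpoint eps (i j : Idx) (s : seq int) : int :=
  if s is x :: s' then
    if i == j then
      Num.max (eps i (other j) s') (x - wgt i (other j) s')
    else eps i (other j) s'
  else 0.

(** On a tie [fop] acts on the front entry and [eop] further in, matching the choice of the smallest
    and of the largest maximizing position in [f_p] and [e_p]. On the empty list the action falls on
    the first position carrying the letter [i], which is 0 or 1. *)
Fixpoint fop (i j : Idx) (s : seq int) : seq int :=
  if s is x :: s' then
    if (i == j) && (eps i (other j) s' <= x - wgt i (other j) s')
    then x + 1 :: s' else x :: fop i (other j) s'
  else if i == j then [:: 1] else [:: 0; 1].

(* Meaningful only when [0 < eps i j s]. *)
Fixpoint eop (i j : Idx) (s : seq int) : seq int :=
  if s is x :: s' then
    if (i == j) && (eps i (other j) s' < x - wgt i (other j) s')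
    then x - 1 :: s' else x :: eop i (other j) s'
  else [::].

(** Stripping by [e_i] as often as possible, in one pass: by the tensor product rule the front entry
    keeps at most [phi_i] of the tail, which is [eps] plus [wgt]. *)
Fixpoint emax (i j : Idx) (s : seq int) : seq int :=
  if s is x :: s' then
    (if i == j then Num.min x (eps i (other j) s' + wgt i (other j) s') else x)
      :: emax i (other j) s'
  else [::].

Lemma eps_ge0 i j s : 0 <= eps i j s.
Proof.
elim: s j => [//|x s IH] j /=; case: ifP => _; last exact: IH.
by have := IH (other j); lia.
Qed.

Lemma wgt_fop k i j s : wgt k j (fop i j s) = wgt k j s - cartan k i.
Proof.
elim: s j => [|x s IH] j /=.
  by case: i; case: j => /=; lia.
case: ifP => [/andP[/eqP-> _]|_] /=; first by nia.
by rewrite IH; lia.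
Qed.

Lemma eps_fop i j s : eps i j (fop i j s) = eps i j s + 1.
Proof.
elim: s j => [|x s IH] j /=.
  by case: i; case: j => /=.
case: eqP => [<-|/eqP ne] /=.
  by case: ifP => h /=; rewrite eqxx ?IH ?wgt_fop ?cartan_diag; move: h; lia.
by rewrite (negPf ne) IH.
Qed.

Lemma wgt_eop k i j s : 0 < eps i j s ->
  wgt k j (eop i j s) = wgt k j s + cartan k i.
Proof.
elim: s j => [|x s IH] j //=.
case: eqP => [<-|/eqP ne] /=; last by move=> h; rewrite IH //; lia.
case: ifP => h /= h'; first by nia.
by rewrite IH; lia.
Qed.

Lemma eps_eop i j s : 0 < eps i j s -> eps i j (eop i j s) = eps i j s - 1.
Proof.
elim: s j => [|x s IH] j //=.
case: eqP => [<-|/eqP ne] /=; last by move=> h; rewrite (negPf ne) IH.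
case: ifP => h /= h'; rewrite eqxx; first by lia.
have h2 : 0 < eps i (other i) s by lia.
by rewrite IH // wgt_eop // cartan_diag; lia.
Qed.

Lemma fop_eop i j s : 0 < eps i j s -> fop i j (eop i j s) = s.
Proof.
elim: s j => [|x s IH] j //=.
case: eqP => [<-|/eqP ne] /=; last by move=> h; rewrite (negPf ne) /= IH.
case: ifP => h /= h'; rewrite eqxx /=.
  by rewrite ifT; [rewrite subrK | lia].
have h2 : 0 < eps i (other i) s by lia.
by rewrite wgt_eop // eps_eop // cartan_diag ifF ?IH //; lia.
Qed.

(** Unlike [fop_eop] this holds only up to trailing zeros, since [fop] may lengthen the list. *)
Lemma eop_fop i j s : teq (eop i j (fop i j s)) s.
Proof.
elim: s j => [|x s IH] j /=.
  by case: i; case: j.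
case: eqP => [<-|/eqP ne] /=.
  case: ifP => h /=; rewrite eqxx /= ?wgt_fop ?eps_fop ?cartan_diag.
    by rewrite ifT; [rewrite addrK | lia].
  by rewrite ifF; [exact/teq_cons/IH | lia].
by rewrite (negPf ne) /=; exact/teq_cons/IH.
Qed.

Lemma emax_eop i j s : 0 < eps i j s -> emax i j (eop i j s) = emax i j s.
Proof.
elim: s j => [|x s IH] j //=.
case: eqP => [<-|/eqP ne] /=; last by move=> h; rewrite (negPf ne) /= IH.
case: ifP => h /= h'; rewrite eqxx /=; first by congr cons; lia.
have h2 : 0 < eps i (other i) s by lia.
by rewrite wgt_eop // eps_eop // cartan_diag IH //; congr cons; lia.
Qed.

Lemma emax_id i j s : eps i j s = 0 -> emax i j s = s.
Proof.
elim: s j => [|x s IH] j //=.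
case: eqP => [<-|/eqP ne] h; last by rewrite IH.
have h0 := eps_ge0 i (other i) s.
by rewrite IH; [congr cons; lia | lia].
Qed.

Lemma eps_iter_eop i j s n : n%:Z <= eps i j s ->
  eps i j (iter n (eop i j) s) = eps i j s - n%:Z.
Proof.
elim: n => [|n IH] h /=; first by lia.
by rewrite eps_eop IH; lia.
Qed.

Lemma emax_iter i j s : emax i j s = iter `|eps i j s|%N (eop i j) s.
Proof.
have [n hn] : exists n : nat, eps i j s = n.
  by exists `|eps i j s|%N; have := eps_ge0 i j s; lia.
rewrite hn absz_nat; elim: n s hn => [|n IH] s hn; first exact: emax_id.
by rewrite iterSr -IH; [rewrite emax_eop //; lia | rewrite eps_eop; lia].
Qed.

Lemma wgt_iter_eop k i j s n : n%:Z <= eps i j s ->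
  wgt k j (iter n (eop i j) s) = wgt k j s + n%:Z * cartan k i.
Proof.
elim: n => [|n IH] h /=; first by lia.
by rewrite wgt_eop ?eps_iter_eop ?IH; lia.
Qed.

Lemma wgt_emax k i j s :
  wgt k j (emax i j s) = wgt k j s + eps i j s * cartan k i.
Proof.
have h := eps_ge0 i j s.
by rewrite emax_iter wgt_iter_eop ?gez0_abs //.
Qed.

Lemma iter_fop_emax i j s : iter `|eps i j s|%N (fop i j) (emax i j s) = s.
Proof.
have H n : n%:Z <= eps i j s -> iter n (fop i j) (iter n (eop i j) s) = s.
  elim: n => [//|n IH] h.
  by rewrite iterSr /= fop_eop ?IH ?eps_iter_eop //; lia.
by rewrite emax_iter H // gez0_abs ?eps_ge0.
Qed.

Lemma wgt_trim i j s : wgt i j (trim s) = wgt i j s.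
Proof.
elim: s j => [//|x s IH] j; rewrite trim_cons /= -IH.
by case: ifP => [/andP[/eqP-> /eqP->]|_] /=; rewrite ?IH; lia.
Qed.

Lemma eps_trim i j s : eps i j (trim s) = eps i j s.
Proof.
elim: s j => [//|x s IH] j; rewrite trim_cons /= -IH -(wgt_trim _ _ s).
by case: ifP => [/andP[/eqP-> /eqP->]|_] /=; [case: ifP|].
Qed.

Lemma fop_trim i j s : teq (fop i j (trim s)) (fop i j s).
Proof.
elim: s j => [//|x s IH] j; rewrite trim_cons /= -(eps_trim _ _ s) -(wgt_trim _ _ s).
case: ifP => [/andP[/eqP-> /eqP e]|_] /=.
  rewrite e /= subrr lexx andbT; have := IH (other j); rewrite e /= neq_other.
  case: (i == j) => /= h; last exact/teq_cons.
  by rewrite add0r; apply: teq_cons; rewrite /teq e.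
by case: ifP => _; apply: teq_cons => //; exact: teq_trim.
Qed.

Lemma eop_trim i j s : 0 < eps i j s -> teq (eop i j (trim s)) (eop i j s).
Proof.
elim: s j => [//|x s IH] j h; rewrite trim_cons.
case: ifP => [/andP[/eqP e0 /eqP e]|_].
  by move: h; rewrite e0 -eps_trim trim_cons e.
move: h; rewrite /= eps_trim wgt_trim.
case: eqP => /= [<-|_] h; last exact/teq_cons/IH.
case: ifP => h2; apply: teq_cons; first exact: teq_trim.
by apply: IH; lia.
Qed.

Lemma emax_trim i j s : teq (emax i j (trim s)) (emax i j s).
Proof.
elim: s j => [//|x s IH] j; rewrite trim_cons /= -(eps_trim _ _ s) -(wgt_trim _ _ s).
case: ifP => [/andP[/eqP-> /eqP e]|_] /=; last exact/teq_cons/IH.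
have := IH (other j); rewrite e /= /teq trim_cons => <-.
by case: (i == j).
Qed.

Lemma wgt_teq i j s s' : teq s s' -> wgt i j s = wgt i j s'.
Proof. by move=> h; rewrite -wgt_trim h wgt_trim. Qed.

Lemma eps_teq i j s s' : teq s s' -> eps i j s = eps i j s'.
Proof. by move=> h; rewrite -eps_trim h eps_trim. Qed.

Lemma fop_teq i j s s' : teq s s' -> teq (fop i j s) (fop i j s').
Proof. by move=> h; rewrite /teq -fop_trim h fop_trim. Qed.

Lemma eop_teq i j s s' : 0 < eps i j s -> teq s s' ->
  teq (eop i j s) (eop i j s').
Proof.
move=> h0 h; rewrite /teq -eop_trim // h eop_trim //.
by rewrite -(eps_teq _ _ h).
Qed.

Lemma emax_teq i j s s' : teq s s' -> teq (emax i j s) (emax i j s').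
Proof. by move=> h; rewrite /teq -emax_trim h emax_trim. Qed.

(** * Strings and the star involution *)

(* [c] is the string of [b] in the direction [j, other j, j, ...]: its entries
   count how often each [e] applies, and they exhaust [b]. *)
Fixpoint is_string (j0 j : Idx) (b c : seq int) : Prop :=
  if c is x :: c' then
    eps j j0 b = x /\ is_string j0 (other j) (emax j j0 b) c'
  else teq b [::].

Lemma is_string_teq j0 j b b' c :
  teq b b' -> is_string j0 j b c -> is_string j0 j b' c.
Proof.
elim: c j b b' => [|x c IH] j b b' h /=; first by rewrite /teq -h.
by rewrite (eps_teq _ _ h) => -[-> h2]; split=> //; apply: IH h2; exact: emax_teq.
Qed.

(** Each stripping moves a multiple of one simple root from [b] to the string, so the star operation
    preserves weights. *)
Lemma wgt_string i j0 j b c : is_string j0 j b c -> wgt i j c = wgt i j0 b.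
Proof.
elim: c j b => [|x c IH] j b /=; first by move=> h; rewrite (wgt_teq _ _ h).
by case=> <- /IH ->; rewrite wgt_emax; lia.
Qed.

Lemma string_nil j0 j c : is_string j0 j [::] c -> teq c [::].
Proof.
elim: c j => [//|x c IH] j /= [<- /IH h].
by rewrite /teq trim_cons h.
Qed.

(* The case [j = j0] is the tensor product rule for [B_j]: stripping [x :: s] in
   direction [j] leaves [min x (phi_j s)] in front. *)
Lemma string_cons j0 j x s c : is_string j0 j (x :: s) c ->
  eps j0 j c = x /\ is_string (other j0) j s (emax j0 j c).
Proof.
elim: c j x s => [|y c IH] j x s.
  move=> h; have := h; rewrite /= /teq trim_cons trim_nil.
  by case: ifP => // /andP[/eqP-> /eqP e] _; split => //; rewrite /teq e.
move=> H; have hw := wgt_string j0 H; move: hw H => /= hw [hy H].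
have [IH1 IH2] := IH _ _ _ H; have hw2 := wgt_string j0 H.
have h0 := eps_ge0 j0 (other j0) s.
(* In the case [j = j0], let [e] and [w] be [eps] and [wgt] of [s] in direction [j]. Then [y] is the
   maximum of [e] and [x - w], the tail [c] has [eps] equal to the minimum of [x] and [e + w] by
   induction, and its weight is [w - 2x + 2y]. Both claims become identities between maxima and
   minima. *)
move: hy hw2 IH1 IH2; rewrite /= eq_sym wgt_emax /=.
case: eqP => [<-|/eqP ne] hy hw2 IH1 IH2 /=; last by rewrite IH1.
rewrite !cartan_diag in hw2.
split; first by lia.
split; last by [].
by lia.
Qed.

Lemma is_string_sym j0 j b c : is_string j0 j b c -> is_string j j0 c b.
Proof.
elim: b j0 c => [|x s IH] j0 c; first exact: string_nil.
by case/string_cons => ? /IH ?.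
Qed.

(** * The string cone *)

Definition letter (j : Idx) (n : nat) : Idx := if odd n then other j else j.

Lemma letterS j n : letter j n.+1 = letter (other j) n.
Proof. by rewrite /letter /=; case: (odd n); rewrite ?otherK. Qed.

Lemma letterSr j n : letter j n.+1 = other (letter j n).
Proof. by rewrite /letter /=; case: (odd n); rewrite ?otherK. Qed.

(** Kashiwara's function [sigma] at position [n], read with the letter [i] there; [eps] is its
    maximum over the positions that carry [i]. *)
Definition sgm (i : Idx) (s : seq int) (n : nat) : int :=
  s`_n - wgt i (other i) (drop n.+1 s).

Lemma sgm_cons i x s n : sgm i (x :: s) n.+1 = sgm i s n.
Proof. by []. Qed.

(** These differences are the linear forms [beta_k] of Nakashima and Zelevinsky; their sign decides
    between neighbouring positions with the same letter. *)
Lemma sgm_step i s n :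
  sgm i s n - sgm i s n.+2 = s`_n + cartan i (other i) * s`_n.+1 + s`_n.+2.
Proof.
have H (r : seq int) m : wgt i m r = wgt i (other m) (behead r) - r`_0 * cartan i m.
  by case: r => //=; lia.
rewrite /sgm (H (drop n.+1 s) (other i)) otherK (H (behead _) i) cartan_diag.
rewrite -!drop1 !drop_drop.
by rewrite !nth_drop !add1n !addn0 -[(2 + n.+1)%N]/n.+3; lia.
Qed.

Lemma eps_ge_sgm i j s n : letter j n = i -> sgm i s n <= eps i j s.
Proof.
elim: s j n => [|x s IH] j [|n].
- by [].
- by [].

- by rewrite /letter /sgm /= drop0 => ->; rewrite eqxx; lia.
rewrite letterS => h; have {IH}h2 := IH _ _ h.
by rewrite sgm_cons /=; case: ifP => // _; lia.
Qed.

Lemma fop_spec i j s : exists n, [/\ letter j n = i, sgm i s n = eps i j s,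
  forall m, (m < n)%N -> letter j m = i -> sgm i s m < eps i j s &
  forall m, (fop i j s)`_m = s`_m + (m == n)%:R].
Proof.
elim: s j => [|x s IH] j /=.
  case: eqP => [<-|/eqP ne].
    by exists 0%N; split => // -[|m] //=; rewrite !nth_nil.
  exists 1%N; split=> //; first by rewrite /letter /=; move: ne; case: (i); case: (j).
    by case=> // _; rewrite /letter /= => e; rewrite e eqxx in ne.
  by case=> [|[|m]] //=; rewrite !nth_nil.
case: eqP => [<-|/eqP ne] /=.
  case: ifP => h.
    exists 0%N; split => //; first by rewrite /sgm /= drop0; lia.
    by case=> [|m] //=; rewrite addr0.
  have [n [h1 h2 h3 h4]] := IH (other i).
  exists n.+1; split=> //; first by rewrite letterS.
  - by rewrite [LHS]h2; lia.
  - move=> [|m]; first by rewrite /sgm /= drop0; lia.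
    by rewrite ltnS letterS => hm hl; have := h3 _ hm hl; rewrite sgm_cons; lia.
  - by case=> [|m] /=; rewrite ?addr0 // h4.
have [n [h1 h2 h3 h4]] := IH (other j).
exists n.+1; split=> //; first by rewrite letterS.
- move=> [|m]; first by rewrite /letter /= => _ e; rewrite e eqxx in ne.
  by rewrite ltnS letterS => hm hl; exact: h3 _ hm hl.
- by case=> [|m] /=; rewrite ?addr0 // h4.
Qed.

Lemma eop_spec i j s : 0 < eps i j s -> exists n,
  [/\ letter j n = i, sgm i s n = eps i j s,
  forall m, (n < m)%N -> letter j m = i -> sgm i s m < eps i j s &
  forall m, (eop i j s)`_m = s`_m - (m == n)%:R].
Proof.
elim: s j => [|x s IH] j //=.
case: eqP => [<-|/eqP ne] /= h0.
  case: ifP => h.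
    exists 0%N; split => //; first by rewrite /sgm /= drop0; lia.
      move=> [//|m] _; rewrite letterS => /(eps_ge_sgm s) hm.
      by rewrite sgm_cons; lia.
    by case=> [|m] //=; rewrite subr0.
  have [|n [h1 h2 h3 h4]] := IH (other i); first by lia.
  exists n.+1; split=> //; first by rewrite letterS.
  - by rewrite [LHS]h2; lia.
  - move=> [//|m].
    by rewrite ltnS letterS => hm hl; have := h3 _ hm hl; rewrite sgm_cons; lia.
  - by case=> [|m] /=; rewrite ?subr0 // h4.
have [n [h1 h2 h3 h4]] := IH (other j) h0.
exists n.+1; split=> //; first by rewrite letterS.
- by move=> [//|m]; rewrite ltnS letterS => hm hl; exact: h3 _ hm hl.
- by case=> [|m] /=; rewrite ?subr0 // h4.
Qed.

Definition coef (i : Idx) : int := - cartan (other i) i.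

(* Two interlaced sequences of Chebyshev type: the coefficients of the rank two
   inequalities of Nakashima and Zelevinsky. *)
Fixpoint K (i : Idx) (n : nat) : int :=
  match n with
  | 0%N => 0
  | n1.+1 => if n1 is n2.+1 then coef i * K (other i) n1 - K i n2 else 1
  end.

Lemma KSS i n : K i n.+2 = coef i * K (other i) n.+1 - K i n.
Proof. by []. Qed.

Definition cone (j : Idx) (c : seq int) : Prop :=
  forall n, K (other (letter j n)) n * c`_n.+1 <= K (letter j n) n.+1 * c`_n.

Lemma cone_nil j : cone j [::].
Proof. by move=> n; rewrite !nth_nil !mulr0. Qed.

Lemma cone_teq j c c' : teq c c' -> cone j c -> cone j c'.
Proof. by move=> /teqP h H n; rewrite -!h. Qed.

Hypothesis a12 : (4 < a1 * a2)%N.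

Lemma coef_gt0 i : 0 < coef i.
Proof. by rewrite /coef; case: i => /=; nia. Qed.

Lemma coef_mul i : 5 <= coef i * coef (other i).
Proof. by rewrite /coef; case: i => /=; nia. Qed.

(** Two steps stay in one of the interlaced sequences, with multiplier at least 3 because [a1 * a2]
    exceeds 4. Single steps may decrease when a coefficient is 1, so growth is measured in steps of
    two. *)
Lemma KS4 i n : K i n.+4 = (coef i * coef (other i) - 2) * K i n.+2 - K i n.
Proof.
rewrite (KSS i n.+2) (KSS (other i) n.+1) otherK.
have := KSS i n; set x := K (other i) n.+1.
by set y := K i n.+2 => ->; nia.
Qed.

Lemma K_step i n : [/\ 0 <= K i n, 0 < K i n.+1, K i n < K i n.+2 & K i n.+1 < K i n.+3].
Proof.
have c1 := coef_gt0 i; have c2 := coef_mul i.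
elim: n => [|n [h1 h2 h3 h4]].
  split => //=; first by lia.
  by rewrite ?mulr1 ?subr0; lia.
split => //; [by lia | by lia |].
by rewrite KS4; nia.
Qed.

Lemma K_ge0 i n : 0 <= K i n.
Proof. by case: (K_step i n). Qed.

Lemma K_gt0 i n : 0 < K i n.+1.
Proof. by case: (K_step i n). Qed.

Lemma K_unbounded i n : n%:Z <= 2 * K i n.
Proof.
suff: n%:Z <= 2 * K i n /\ n.+1%:Z <= 2 * K i n.+1 by case.
elim: n => [//|n [h1 h2]]; split=> //.
by case: (K_step i n); lia.
Qed.

(** Only the inequality whose left side grows is at risk. There the previous position with letter
    [i] has strictly smaller [sgm], which bounds the new entry by [coef] times its predecessor minus
    the entry before that; multiplying by [K] and adding the preceding inequality gives the
    recursion of [K]. At index 0 the left coefficient is 0. *)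
Lemma cone_fop i j c : cone j c -> cone j (fop i j c).
Proof.
move=> H m; have [n [hl hs hlt hn]] := fop_spec i j c.
have Km := K_ge0 (letter j m) m.+1.
case: (m.+1 =P n) => [e|ne]; last first.
  rewrite !hn; have := H m; have -> : (m.+1 == n) = false by apply/eqP.
  by case: (m == n); rewrite ?mulr0n ?mulr1n ?addr0 ?mulrDr ?mulr1; lia.
rewrite !hn -e eqxx (ltn_eqF (ltnSn m)) mulr0n mulr1n addr0.
case: m H Km e => [|m] H Km e.
  by have := H 0%N; rewrite /= !mul0r !mul1r.
have e2 : letter j m = i by rewrite -hl -e !letterSr otherK.
have := hlt m; rewrite -e ltnS leqnSn => /(_ isT e2).
rewrite -hs -e => h.
have := sgm_step i c m; have := H m; rewrite letterSr e2 otherK KSS otherK.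
have -> : cartan i (other i) = - coef (other i) by rewrite /coef otherK opprK.
have Kp := K_ge0 i m.+1 => h1 h2.
have h3 : c`_m.+2 + 1 <= coef (other i) * c`_m.+1 - c`_m by lia.
have := ler_wpM2l Kp h3.
by move: h1; nia.
Qed.

(** Mirror image: now the right side shrinks, and the comparison is with the next position of the
    same letter and the following inequality. *)
Lemma cone_eop i j c : 0 < eps i j c -> cone j c -> cone j (eop i j c).
Proof.
move=> h0 H m; have [n [hl hs hlt hn]] := eop_spec h0.
have Km := K_ge0 (other (letter j m)) m.
case: (m =P n) => [e|ne]; last first.
  rewrite !hn; have := H m; have -> : (m == n) = false by apply/eqP.
  by case: (m.+1 == n); rewrite ?mulr0n ?mulr1n ?subr0 ?mulrBr ?mulr1; lia.
rewrite !hn -e eqxx (gtn_eqF (ltnSn m)) mulr0n mulr1n subr0.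
have e2 : letter j m.+2 = i by rewrite !letterSr otherK e.
have := hlt m.+2; rewrite -e ltnS leqnSn => /(_ isT e2).
rewrite -hs -e => h.
have := sgm_step i c m; have := H m.+1; rewrite letterSr e hl otherK KSS otherK.
have -> : cartan i (other i) = - coef (other i) by rewrite /coef otherK opprK.
have Kp := K_ge0 i m.+1; rewrite -e => h1 h2.
have h3 : coef (other i) * c`_m.+1 - c`_m.+2 <= c`_m - 1 by lia.
have := ler_wpM2l Kp h3.
by move: h1; nia.
Qed.

Lemma cone_iter_fop i j c n : cone j c -> cone j (iter n (fop i j) c).
Proof. by move=> H; elim: n => [//|n IH] /=; exact: cone_fop. Qed.

Lemma cone_emax i j c : cone j c -> cone j (emax i j c).
Proof.
move=> H; rewrite emax_iter; have := eps_ge0 i j c => h.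
have {h}: `|eps i j c|%N%:Z <= eps i j c by lia.
elim: `|eps i j c|%N => [//|n IH] h /=.
by apply: cone_eop; [rewrite eps_iter_eop; lia | apply: IH; lia].
Qed.

(** Induction backwards from the end of the list, beyond which all entries are 0. *)
Lemma cone_ge0 j c n : cone j c -> 0 <= c`_n.
Proof.
move=> H; have [m hm] := ubnP (size c - n); elim: m n hm => [//|m IH] n hm.
have [h|h] := leqP (size c) n; first by rewrite nth_default.
have h2 : 0 <= c`_n.+1 by apply: IH; lia.
have := H n; have := mulr_ge0 (K_ge0 (other (letter j n)) n) h2.
move=> h3 h4; have := le_trans h3 h4.
by rewrite pmulr_rge0 // K_gt0.
Qed.

(** By symmetry [b] is the string of [c], so [c] is rebuilt from the zero sequence by operators
    [fop], which preserve the cone. *)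
Lemma string_cone j0 j b c : is_string j0 j b c -> cone j c.
Proof.
move/is_string_sym; elim: b j0 c => [|x s IH] j0 c /=.
  by move=> h; apply: (cone_teq (esym h)); exact: cone_nil.
case=> hx /IH h; rewrite -(iter_fop_emax j0 j c).
exact: cone_iter_fop.
Qed.

Definition sumz (s : seq int) : int := foldr +%R 0 s.

Lemma sumz_eop i j s : 0 < eps i j s -> sumz (eop i j s) = sumz s - 1.
Proof.
elim: s j => [//|x s IH] j /=.
case: eqP => [<-|/eqP ne] /= h; last by rewrite IH //; lia.
by case: ifP => h2 /=; rewrite ?IH; lia.
Qed.

Lemma sumz_emax i j s : sumz (emax i j s) = sumz s - eps i j s.
Proof.
have H n : n%:Z <= eps i j s -> sumz (iter n (eop i j) s) = sumz s - n%:Z.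
  elim: n => [|n IH] h /=; first by lia.
  by rewrite sumz_eop ?eps_iter_eop ?IH; lia.
by rewrite emax_iter H ?gez0_abs // eps_ge0.
Qed.

Lemma sumz_teq0 s : teq s [::] -> sumz s = 0.
Proof.
elim: s => [//|x s IH]; rewrite /teq trim_cons trim_nil.
by case: ifP => // /andP[/eqP-> /eqP e] _ /=; rewrite IH.
Qed.

(** Only the generator is killed by every [e_i]: once the tail vanishes, the first entry is its own
    [sigma] value and hence nonpositive. *)
Lemma eps_eq0_nil j c : (forall n, 0 <= c`_n) -> (forall i, eps i j c <= 0) ->
  teq c [::].
Proof.
elim: c j => [//|x s IH] j h0 h.
have e : teq s [::].
  apply: (IH (other j)) => [n|i]; first exact: (h0 n.+1).
  by have := h i => /=; case: ifP => // _; lia.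
have := h j; have := h0 0%N; rewrite /= eqxx (wgt_teq _ _ e) /= => h1 h2.
by rewrite /teq trim_cons e (_ : x = 0) //; lia.
Qed.

Lemma sumz_ge0 c : (forall n, 0 <= c`_n) -> 0 <= sumz c.
Proof.
elim: c => [//|x s IH] h /=.
have := h 0%N; have := IH (fun n => h n.+1) => /=; lia.
Qed.

Lemma sumz_le0 c : (forall n, 0 <= c`_n) -> sumz c <= 0 -> teq c [::].
Proof.
elim: c => [//|x s IH] h /= h2.
have h3 := h 0%N; have h4 := sumz_ge0 (fun n => h n.+1 : 0 <= s`_n); rewrite /= in h3.
by rewrite /teq trim_cons IH => [|n|]; [rewrite (_ : x = 0) //; lia | exact: (h n.+1) | lia].
Qed.

(** Of two consecutive strippings at least one removes something unless the sequence is zero, hence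
    the factor 2. The length is prescribed because [star_p] and [star_m] compute a fixed number of
    entries. *)
Lemma cone_string j0 j b N : cone j0 b -> 2 * sumz b <= N%:Z ->
  exists2 c, size c = N & is_string j0 j b c.
Proof.
elim/ltn_ind: N j b => N IH j b H hN.
have h0 n := cone_ge0 n H.
case: N IH hN => [|N] IH hN.
  by exists [::] => //; apply: sumz_le0 => //; lia.
have e0 := eps_ge0 j j0 b.
have H1 := cone_emax j H.
have [e|e] := eqVneq (eps j j0 b) 0; last first.
  have [||c hc1 hc2] := IH N _ (other j) _ H1 => //.
    by rewrite sumz_emax; lia.
  by exists (eps j j0 b :: c) => /=; [rewrite hc1 | split].
case: N IH hN => [|N] IH hN.
  exists [:: 0] => //=; split=> //; rewrite emax_id //.
  by apply: sumz_le0 => //; lia.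
have H2 := cone_emax (other j) H.
have [||c hc1 hc2] := IH N _ j _ H2; first by lia.
  rewrite sumz_emax; have := eps_ge0 (other j) j0 b.
  case: (ltrgt0P (eps (other j) j0 b)) => // [h _|h _]; first by lia.
  have z : teq b [::].
    apply: (@eps_eq0_nil j0) => // i.
    by case: (i =P j) => [->|/eqP]; rewrite ?e // -neq_other => /eqP->; rewrite h.
  have -> : sumz b = 0 by apply: (sumz_teq0 z).
  by lia.
exists [:: 0, eps (other j) j0 b & c] => /=; first by rewrite hc1.
by rewrite emax_id // otherK.
Qed.

(** * Comparison with the closed formulas for the crystal operators *)

Local Notation sigma := (Defs.sigma a1 a2).

(** Negation turns the minus crystal into one of nonnegative sequences and exchanges the roles of
    [e] and [f], so that [f_m] becomes [eop], [e_m] becomes [fop] and [phi_m] becomes [eps]. *)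
Definition opps (s : seq int) : seq int := [seq - x | x <- s].

Lemma oppsK : involutive opps.
Proof. by move=> s; rewrite /opps -map_comp map_id_in // => x _ /=; rewrite opprK. Qed.

Lemma nth_opps s n : (opps s)`_n = - s`_n.
Proof.
have [h|h] := ltnP n (size s); first by rewrite (nth_map 0).
by rewrite !nth_default ?oppr0 // size_map.
Qed.

Lemma trim_opps s : trim (opps s) = opps (trim s).
Proof. exact: trim_map_opp. Qed.

Lemma iplusE n : iplus n = letter I1 n.
Proof. by rewrite /iplus /letter /=; case: (odd n). Qed.

Lemma iminusE n : iminus n = letter I2 n.
Proof. by []. Qed.

Lemma wgt_sum i j s :
  wgt i j s = - \sum_(0 <= n < size s) s`_n * cartan i (letter j n).
Proof.
elim: s j => [|x s IH] j; first by rewrite big_geq // oppr0.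
rewrite /= big_nat_recl //= IH opprD [RHS]addrC; congr (- _ + _).
by apply: eq_big_nat => n _; rewrite letterS.
Qed.

Section Comparison.
Variables (ind : nat -> Idx) (j : Idx).
Hypothesis indE : forall n, ind n = letter j n.

Lemma wtcE i s : wtc a1 a2 ind i s = wgt i j s.
Proof.
by rewrite wgt_sum /wtc; congr (- _); apply: eq_bigr => n _; rewrite indE.
Qed.

Lemma sigmaE s n : sigma ind s n = sgm (ind n) s n.
Proof.
rewrite /Defs.sigma /sgm wgt_sum opprK; congr (_ + _).
rewrite size_drop -{1}(add0n n.+1) big_addn.
apply: eq_big_nat => m _; rewrite nth_drop mulrC (addnC m).
suff -> : ind (n.+1 + m)%N = letter (other (ind n)) m by [].
by rewrite !indE; elim: m => [|m IH]; rewrite ?addn0 ?addnS !letterSr // -IH letterSr.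
Qed.

Lemma maxl_ge (l : seq int) x : x \in l -> x <= maxl l.
Proof.
elim: l => [//|y l IH]; rewrite inE /= => /orP[/eqP->|/IH]; first by lia.
by rewrite -/(maxl l); lia.
Qed.

Lemma maxl_le (l : seq int) b : 0 <= b -> (forall x, x \in l -> x <= b) ->
  maxl l <= b.
Proof.
move=> h0; elim: l => [//|y l IH] h /=; rewrite -/(maxl l).
have := h y; rewrite inE eqxx => /(_ isT).
have: maxl l <= b by apply: IH => x hx; apply: h; rewrite inE hx orbT.
by lia.
Qed.

Lemma maxl_ge0 (l : seq int) : 0 <= maxl l.
Proof. by elim: l => [//|y l IH] /=; rewrite -/(maxl l); lia. Qed.

Lemma sgm_default i s n : (size s <= n)%N -> sgm i s n = 0.
Proof. by move=> h; rewrite /sgm nth_default // drop_oversize //; lia. Qed.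

Lemma maxl_sigma i s :
  maxl [seq sigma ind s n | n <- iota 0 (size s) & ind n == i] = eps i j s.
Proof.
apply/eqP; rewrite eq_le; apply/andP; split.
  apply: maxl_le; first exact: eps_ge0.
  move=> x /mapP[n]; rewrite mem_filter => /andP[/eqP hn _] ->.
  by rewrite sigmaE hn; apply: eps_ge_sgm; rewrite -indE.
have [n [hl hs _ _]] := fop_spec i j s.
(* A maximizing position beyond the list has [sgm] equal to 0, the default value of [maxl]. *)
have [h|h] := leqP (size s) n.
  by rewrite -hs sgm_default // maxl_ge0.
rewrite -hs -{1}hl -indE -sigmaE; apply: maxl_ge; apply: map_f.
by rewrite mem_filter indE hl eqxx mem_iota add0n h.
Qed.

Lemma find_iota0 (P : pred nat) N n : P n -> (n < N)%N ->
  (forall m, (m < n)%N -> ~~ P m) -> find P (iota 0 N) = n.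
Proof.
move=> hP hN hlt; have hh : has P (iota 0 N).
  by apply/hasP; exists n; rewrite // mem_iota.
have hf := hh; rewrite has_find size_iota in hf.
have hPf := nth_find 0%N hh; rewrite nth_iota // add0n in hPf.
apply/eqP; rewrite eqn_leq; apply/andP; split; rewrite leqNgt; apply/negP => h.
  by have := before_find 0%N h; rewrite nth_iota ?add0n ?hP.
by have := hlt _ h; rewrite hPf.
Qed.

Lemma maxnl_eq (l : seq nat) n : n \in l -> (forall m, m \in l -> (m <= n)%N) ->
  maxnl l = n.
Proof.
move=> h1 h2; apply/eqP; rewrite eqn_leq; apply/andP; split.
  elim: l {h1} h2 => [//|y l IH] h /=; rewrite geq_max h ?mem_head //=.
  by apply: IH => m hm; apply: h; rewrite inE hm orbT.
elim: l {h2} h1 => [//|y l IH]; rewrite inE /= leq_max => /orP[/eqP->|/IH ->].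
  by rewrite leqnn.
by rewrite orbT.
Qed.

Lemma addat_find i s :
  addat s (find (fun n => (ind n == i) && (sigma ind s n == eps i j s))
                (iota 0 (size s + 2))) 1 = trim (fop i j s).
Proof.
have [n [hl hs hlt hn]] := fop_spec i j s.
rewrite (@find_iota0 _ _ n).
- apply/teqP => m; rewrite nth_set_nth /= hn.
  by case: eqP => [->|_] //; rewrite addr0.
- by rewrite indE hl eqxx sigmaE indE hl hs /=.
(* Searching up to [size s + 2] suffices: past that bound the position two earlier has the same
   letter and also [sgm] 0, so [n] would not be the first maximum. *)
- rewrite ltnNge; apply/negP => h.
  have [k ek] : exists k, n = k.+2 by exists (n - 2)%N; lia.
  have: sgm i s k < eps i j s.
    by apply: hlt; [rewrite ek; lia | rewrite -hl ek !letterSr otherK].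
  by rewrite -hs !sgm_default ?ltxx //; lia.
- move=> m hm; apply/negP => /andP[/eqP e /eqP]; rewrite sigmaE e => h.
  by have := hlt m hm; rewrite -indE h ltxx => /(_ e).
Qed.

Lemma addat_max i s : 0 < eps i j s ->
  addat s (maxnl [seq n <- iota 0 (size s) |
                   (ind n == i) && (sigma ind s n == eps i j s)]) (-1)
  = trim (eop i j s).
Proof.
move=> h0; have [n [hl hs hlt hn]] := eop_spec h0.
rewrite (@maxnl_eq _ n).
- apply/teqP => m; rewrite nth_set_nth /= hn.
  by case: eqP => [->|_] //; rewrite subr0.
- rewrite mem_filter indE hl eqxx sigmaE indE hl hs eqxx mem_iota add0n /= ltnNge.
  by apply/negP => h; move: h0; rewrite -hs sgm_default.
- move=> m; rewrite mem_filter => /andP[/andP[/eqP e /eqP]]; rewrite sigmaE e => h _.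
  rewrite leqNgt; apply/negP => hm.
  by have := hlt m hm; rewrite -indE h ltxx => /(_ e).
Qed.

End Comparison.

Lemma eps_pE i s : eps_p a1 a2 i s = eps i I1 s.
Proof. exact: (maxl_sigma iplusE). Qed.

Lemma f_pE i s : f_p a1 a2 i s = trim (fop i I1 s).
Proof. by rewrite /f_p -/(eps_p a1 a2 i s) eps_pE (addat_find iplusE). Qed.

Lemma e_pE i s : e_p a1 a2 i s =
  if 0 < eps i I1 s then Some (trim (eop i I1 s)) else None.
Proof.
rewrite /e_p -/(eps_p a1 a2 i s) eps_pE.
by case: ifP => // h; rewrite (addat_max iplusE).
Qed.

Lemma minl_opp (l : seq int) : minl l = - maxl [seq - x | x <- l].
Proof.
by elim: l => [//|x l IH] /=; rewrite -/(minl l) -/(maxl _) IH oppr_max opprK.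
Qed.

Lemma sigma_opps ind t n : sigma ind (opps t) n = - sigma ind t n.
Proof.
rewrite /Defs.sigma nth_opps size_map opprD -sumrN; congr (_ + _).
by apply: eq_bigr => m _; rewrite nth_opps mulrN.
Qed.

Lemma sig_mE i t : sig_m a1 a2 i t = - eps i I2 (opps t).
Proof.
rewrite /sig_m minl_opp -(maxl_sigma iminusE) size_map -map_comp.
by congr (- maxl _); apply: eq_map => n /=; rewrite sigma_opps.
Qed.

Lemma phi_mE i t : phi_m a1 a2 i t = eps i I2 (opps t).
Proof. by rewrite /phi_m sig_mE opprK. Qed.

Lemma wtc_m i t : wtc a1 a2 iminus i t = - wgt i I2 (opps t).
Proof.
rewrite (wtcE iminusE) !wgt_sum size_map opprK -sumrN.
by apply: eq_bigr => m _; rewrite nth_opps mulNr.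
Qed.

Lemma addat_opps t m d : addat t m d = opps (addat (opps t) m (- d)).
Proof.
rewrite /addat -trim_opps; apply/teqP => n.
rewrite nth_opps !nth_set_nth /= nth_opps.
by case: eqP => _; rewrite ?nth_opps ?opprK // -opprD opprK.
Qed.

Lemma f_mE i t : f_m a1 a2 i t =
  if 0 < eps i I2 (opps t) then Some (opps (trim (eop i I2 (opps t)))) else None.
Proof.
rewrite /f_m sig_mE oppr_lt0; case: ifP => // h.
rewrite -(addat_max iminusE) // addat_opps size_map;
congr (Some (opps (addat _ (maxnl _) _))).
by apply: eq_filter => n; rewrite sigma_opps eqr_oppLR.
Qed.

Lemma e_mE i t : e_m a1 a2 i t = Some (opps (trim (fop i I2 (opps t)))).
Proof.
rewrite /e_m sig_mE -(addat_find iminusE) addat_opps size_map opprK.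
congr (Some (opps (addat _ _ _))).
by apply: eq_find => n; rewrite sigma_opps eqr_oppLR.
Qed.

(** * The tensor product rule *)

Lemma wtE i x : wt a1 a2 i x =
  wgt i I1 (zp x) + wpair i (zmu x) - wgt i I2 (opps (zm x)).
Proof. by rewrite /wt (wtcE iplusE) wtc_m. Qed.

(** Since [phi - eps] is the weight on each factor, the rule becomes a comparison with the total
    weight, the quantity that extremality controls. *)
Lemma ftE i x : ft a1 a2 i x =
  if eps i I2 (opps (zm x)) - eps i I1 (zp x) < wt a1 a2 i x then
    Some (Elt (trim (fop i I1 (zp x))) (zmu x) (zm x))
  else if 0 < eps i I2 (opps (zm x)) then
    Some (Elt (zp x) (zmu x) (opps (trim (eop i I2 (opps (zm x))))))
  else None.
Proof.
rewrite /ft /eps_m /phiL eps_pE phi_mE wtc_m (wtcE iplusE) wtE f_pE f_mE.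
set A := (X in if X then _ else _); set B := (X in _ = if X then _ else _).
have -> : A = B by rewrite /A /B; apply/idP/idP; lia.
by case: ifP => // _; case: ifP.
Qed.

Lemma etE i x : et a1 a2 i x =
  if eps i I2 (opps (zm x)) - eps i I1 (zp x) <= wt a1 a2 i x then
    if 0 < eps i I1 (zp x) then
      Some (Elt (trim (eop i I1 (zp x))) (zmu x) (zm x))
    else None
  else Some (Elt (zp x) (zmu x) (opps (trim (fop i I2 (opps (zm x)))))).
Proof.
rewrite /et /eps_m /phiL eps_pE phi_mE wtc_m (wtcE iplusE) wtE e_pE e_mE.
set A := (X in if X then _ else _); set B := (X in _ = if X then _ else _).
have -> : A = B by rewrite /A /B; apply/idP/idP; lia.
by case: ifP => // _; case: ifP.
Qed.
(** * The images of the embeddings and the star operation *)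

Lemma ImP_cone s : ImP a1 a2 s -> cone I1 s.
Proof.
case=> js ->; elim/last_ind: js => [|js j IH]; first exact: cone_nil.
rewrite foldl_rcons f_pE; apply: (cone_teq (esym (teq_trim _))).
exact: cone_fop.
Qed.

Lemma ImM_cone t : Defs.ImM a1 a2 t -> trim t = t /\ cone I2 (opps t).
Proof.
case=> js; elim/last_ind: js t => [|js j IH] t.
  by case=> ->; split=> //; exact: cone_nil.
rewrite foldl_rcons; case: (foldl _ _ _) IH => [t'|//] /(_ _ erefl)[_ IH] /=.
rewrite e_mE => -[->]; rewrite oppsK trim_opps trimK; split=> //.
apply: (cone_teq (esym (teq_trim _))).
exact: cone_fop.
Qed.

Lemma iter_e_p i s n : n%:Z <= eps i I1 s ->
  exists2 s', iter_opt n (e_p a1 a2 i) s = Some s' & teq s' (iter n (eop i I1) s).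
Proof.
elim: n => [|n IH] h /=; first by exists s.
have [|s' -> e] := IH; first by lia.
have h2 : 0 < eps i I1 s' by rewrite (eps_teq _ _ e) eps_iter_eop; lia.
rewrite /= e_pE h2; eexists; first by [].
by rewrite /teq trimK; exact: eop_teq.
Qed.

Lemma iter_f_m i t n : n%:Z <= eps i I2 (opps t) ->
  exists2 t', iter_opt n (f_m a1 a2 i) t = Some t' &
    teq (opps t') (iter n (eop i I2) (opps t)).
Proof.
elim: n => [|n IH] h /=; first by exists t.
have [|t' -> e] := IH; first by lia.
have h2 : 0 < eps i I2 (opps t') by rewrite (eps_teq _ _ e) eps_iter_eop; lia.
rewrite /= f_mE h2; eexists; first by [].
by rewrite oppsK /teq trimK; exact: eop_teq.
Qed.

Lemma st_pS s k : teq (st_p a1 a2 s k.+1) (emax (iplus k) I1 (st_p a1 a2 s k)).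
Proof.
rewrite /= eps_pE emax_iter; set s' := st_p _ _ _ _.
have [|s'' -> //] := iter_e_p (i := iplus k) (s := s') (n := `|eps (iplus k) I1 s'|%N).
by rewrite gez0_abs // eps_ge0.
Qed.

Lemma st_mS t k :
  teq (opps (st_m a1 a2 t k.+1)) (emax (iminus k) I2 (opps (st_m a1 a2 t k))).
Proof.
rewrite /= phi_mE emax_iter; set s' := st_m _ _ _ _.
have [|s'' -> //] :=
  iter_f_m (i := iminus k) (t := s') (n := `|eps (iminus k) I2 (opps s')|%N).
by rewrite gez0_abs // eps_ge0.
Qed.

Lemma sumz_le_hgt s : sumz s <= (hgt s)%:Z.
Proof.
have -> : hgt s = (\sum_(x <- s) absz x)%N by rewrite /hgt [RHS](big_nth (0 : int)).
elim: s => [|x s IH] /=; first by rewrite big_nil.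
by rewrite big_cons PoszD -/(sumz s); lia.
Qed.

Lemma string_st_p s k c : is_string I1 (iplus k) (st_p a1 a2 s k) c ->
  c = [seq eps_p a1 a2 (iplus n) (st_p a1 a2 s n) | n <- iota k (size c)].
Proof.
elim: c k => [//|x c IH] k /= [hx h]; rewrite eps_pE hx; congr cons.
apply: IH; rewrite (_ : iplus k.+1 = other (iplus k)).
  by apply: is_string_teq h; apply: esym; exact: st_pS.
by rewrite !iplusE letterSr.
Qed.

Lemma string_st_m t k c : is_string I2 (iminus k) (opps (st_m a1 a2 t k)) c ->
  c = [seq phi_m a1 a2 (iminus n) (st_m a1 a2 t n) | n <- iota k (size c)].
Proof.
elim: c k => [//|x c IH] k /= [hx h]; rewrite phi_mE hx; congr cons.
apply: IH; rewrite (_ : iminus k.+1 = other (iminus k)).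
  by apply: is_string_teq h; apply: esym; exact: st_mS.
by rewrite !iminusE letterSr.
Qed.

Lemma star_pE s : cone I1 s ->
  exists2 c, is_string I1 I1 s c & star_p a1 a2 s = trim c.
Proof.
move=> H; have [|c hc1 hc2] := cone_string I1 (N := 2 * hgt s + 2) H.
  by have := sumz_le_hgt s; lia.
by exists c => //; rewrite /star_p -hc1 -(@string_st_p s 0 c).
Qed.

Lemma star_mE t : cone I2 (opps t) ->
  exists2 c, is_string I2 I2 (opps t) c & opps (star_m a1 a2 t) = trim c.
Proof.
move=> H; have [|c hc1 hc2] := cone_string I2 (N := 2 * hgt t + 2) H.
  have -> : hgt t = hgt (opps t).
    by rewrite /hgt size_map; apply: eq_bigr => n _; rewrite nth_opps abszN.
  by have := sumz_le_hgt (opps t); lia.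
exists c => //; rewrite /star_m -hc1 -trim_opps /opps -map_comp.
congr trim; rewrite [RHS](@string_st_m t 0 c) //.
by apply: eq_map => n /=; rewrite opprK.
Qed.

(** * Iterated operators on tensor products *)

Lemma eps_iter_fop i j s n : eps i j (iter n (fop i j) s) = eps i j s + n%:Z.
Proof. by elim: n => [|n IH] /=; rewrite ?eps_fop ?IH; lia. Qed.

Lemma wgt_iter_fop k i j s n :
  wgt k j (iter n (fop i j) s) = wgt k j s - n%:Z * cartan k i.
Proof. by elim: n => [|n IH] /=; rewrite ?wgt_fop ?IH; lia. Qed.

Lemma emax_iter_fop i j s n : eps i j s = 0 ->
  teq (emax i j (iter n (fop i j) s)) s.
Proof.
move=> h; elim: n => [|n IH] /=; first by rewrite emax_id.
rewrite -emax_eop; last by rewrite eps_fop; have := eps_ge0 i j (iter n (fop i j) s); lia.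
by rewrite /teq -IH; apply: emax_teq; exact: eop_fop.
Qed.

Lemma string_behead j0 j b c : is_string j0 j b c ->
  eps j j0 b = c`_0 /\ is_string j0 (other j) (emax j j0 b) (behead c).
Proof.
case: c => [|x c] //= h; split; first by rewrite (eps_teq _ _ h).
exact: (emax_teq _ _ h).
Qed.

(* The minus component is recorded with its signs reversed, so that both
   components obey the same rules. *)
Definition rep (x : elt) (mu : weight) (s r : seq int) : Prop :=
  [/\ zmu x = mu, teq (zp x) s & teq (opps (zm x)) r].

Definition pwt (mu : weight) (i : Idx) (s r : seq int) : int :=
  wgt i I1 s + wpair i mu - wgt i I2 r.

Section Tensor.
Variables (x : elt) (mu : weight) (s r : seq int) (i : Idx).
Hypothesis xsr : rep x mu s r.

Lemma wt_rep k : wt a1 a2 k x = pwt mu k s r.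
Proof.
case: xsr => h1 h2 h3.
by rewrite wtE h1 (wgt_teq _ _ h2) (wgt_teq _ _ h3).
Qed.

Lemma eps_rep_p k : eps k I1 (zp x) = eps k I1 s.
Proof. by case: xsr => _ h _; exact: eps_teq. Qed.

Lemma eps_rep_m k : eps k I2 (opps (zm x)) = eps k I2 r.
Proof. by case: xsr => _ _ h; exact: eps_teq. Qed.

Lemma ft_left : eps i I2 r - eps i I1 s < pwt mu i s r ->
  exists2 x', ft a1 a2 i x = Some x' & rep x' mu (fop i I1 s) r.
Proof.
move=> h; rewrite ftE wt_rep eps_rep_p eps_rep_m h; eexists; first by [].
by case: xsr => h1 h2 h3; split=> //=; rewrite /teq trimK; exact: fop_teq.
Qed.

Lemma ft_right : pwt mu i s r <= eps i I2 r - eps i I1 s -> 0 < eps i I2 r ->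
  exists2 x', ft a1 a2 i x = Some x' & rep x' mu s (eop i I2 r).
Proof.
move=> h h2; rewrite ftE wt_rep eps_rep_p eps_rep_m ltNge h h2; eexists; first by [].
case: xsr => ? ? h3; split=> //=; rewrite oppsK /teq trimK; apply: eop_teq => //.
by rewrite eps_rep_m.
Qed.

Lemma ft_none : ft a1 a2 i x = None ->
  pwt mu i s r <= - eps i I1 s /\ eps i I2 r = 0.
Proof.
rewrite ftE wt_rep eps_rep_p eps_rep_m; case: ltP => // h1; case: ltP => // h2 _.
by have := eps_ge0 i I2 r; lia.
Qed.

Lemma et_left : eps i I2 r - eps i I1 s <= pwt mu i s r -> 0 < eps i I1 s ->
  exists2 x', et a1 a2 i x = Some x' & rep x' mu (eop i I1 s) r.
Proof.
move=> h h2; rewrite etE wt_rep eps_rep_p eps_rep_m h h2; eexists; first by [].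
case: xsr => ? h3 ?; split=> //=; rewrite /teq trimK; apply: eop_teq => //.
by rewrite eps_rep_p.
Qed.

Lemma et_right : pwt mu i s r < eps i I2 r - eps i I1 s ->
  exists2 x', et a1 a2 i x = Some x' & rep x' mu s (fop i I2 r).
Proof.
move=> h; rewrite etE wt_rep eps_rep_p eps_rep_m leNgt h; eexists; first by [].
by case: xsr => ? ? h3; split=> //=; rewrite oppsK /teq trimK; exact: fop_teq.
Qed.

Lemma et_none : et a1 a2 i x = None ->
  eps i I2 r <= pwt mu i s r /\ eps i I1 s = 0.
Proof.
rewrite etE wt_rep eps_rep_p eps_rep_m; case: leP => // h1; case: ltP => // h2 _.
by have := eps_ge0 i I1 s; lia.
Qed.

End Tensor.

Lemma iter_optD (T : Type) (g : T -> option T) m n x :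
  iter_opt (m + n) g x = obind (iter_opt m g) (iter_opt n g x).
Proof.
elim: m => [|m IH] /=; first by case: iter_opt.
by rewrite IH; case: (iter_opt n g x).
Qed.

Lemma iter_et_right x mu s r i n : rep x mu s r -> eps i I2 r = 0 ->
  pwt mu i s r <= - eps i I1 s - n%:Z ->
  exists2 x', iter_opt n (et a1 a2 i) x = Some x' & rep x' mu s (iter n (fop i I2) r).
Proof.
move=> h h0; elim: n => [|n IH] hn /=; first by exists x.
have [|x' -> h'] := IH; first by lia.
apply: et_right => //.
move: hn; rewrite /pwt eps_iter_fop wgt_iter_fop cartan_diag; lia.
Qed.

Lemma iter_et_left x mu s r i n : rep x mu s r -> n%:Z <= eps i I1 s ->
  eps i I2 r - eps i I1 s <= pwt mu i s r ->
  exists2 x', iter_opt n (et a1 a2 i) x = Some x' & rep x' mu (iter n (eop i I1) s) r.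
Proof.
move=> h; elim: n => [|n IH] hn hw /=; first by exists x.
have [||x' -> h'] := IH; [by lia | by [] |].
have h1 : n%:Z <= eps i I1 s by lia.
apply: et_left => //; last by rewrite eps_iter_eop //; lia.
by move: hw; rewrite /pwt eps_iter_eop // wgt_iter_eop // cartan_diag; lia.
Qed.

Lemma iter_ft_left x mu s r i n : rep x mu s r -> eps i I1 s = 0 ->
  eps i I2 r + n%:Z <= pwt mu i s r ->
  exists2 x', iter_opt n (ft a1 a2 i) x = Some x' & rep x' mu (iter n (fop i I1) s) r.
Proof.
move=> h h0; elim: n => [|n IH] hn /=; first by exists x.
have [|x' -> h'] := IH; first by lia.
apply: ft_left => //.
move: hn; rewrite /pwt eps_iter_fop wgt_iter_fop cartan_diag; lia.
Qed.

Lemma iter_ft_right x mu s r i n : rep x mu s r -> n%:Z <= eps i I2 r ->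
  pwt mu i s r <= eps i I2 r - eps i I1 s ->
  exists2 x', iter_opt n (ft a1 a2 i) x = Some x' & rep x' mu s (iter n (eop i I2) r).
Proof.
move=> h; elim: n => [|n IH] hn hw /=; first by exists x.
have [||x' -> h'] := IH; [by lia | by [] |].
have h1 : n%:Z <= eps i I2 r by lia.
apply: ft_right => //; last by rewrite eps_iter_eop //; lia.
by move: hw; rewrite /pwt eps_iter_eop // wgt_iter_eop // cartan_diag; lia.
Qed.

(** As [f_i] kills [x], the right factor has [eps] 0. The power [e_i^P] first acts [P - eps i I1 s]
    times on the right factor and then strips the left factor completely. *)
Lemma S_i_down x mu s r i (P : int) : rep x mu s r -> 0 <= P ->
  pwt mu i s r = - P -> ft a1 a2 i x = None ->
  [/\ eps i I2 r = 0, eps i I1 s <= P &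
   exists2 x', S_i a1 a2 i x = Some x' &
     rep x' mu (emax i I1 s) (iter `|P - eps i I1 s|%N (fop i I2) r)].
Proof.
move=> h P0 hP /(ft_none h)[h1 h2]; have e0 := eps_ge0 i I1 s.
split=> //; first by lia.
set n := `|P - eps i I1 s|%N; have hn : n%:Z = P - eps i I1 s by rewrite /n; lia.
have [|x1 h3 h4] := iter_et_right (n := n) h h2; first by lia.
have [||x2 h5 h6] := iter_et_left (i := i) (n := `|eps i I1 s|%N) h4.
- by lia.
- by move: hP; rewrite /pwt eps_iter_fop wgt_iter_fop cartan_diag; lia.
exists x2; last by rewrite emax_iter.
rewrite /S_i (wt_rep h) hP.
have -> : `|- P|%N = (`|eps i I1 s| + n)%N by lia.
(* If [P = 0] the reflection takes its other branch, but then no operator is applied at all. *)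
case: ifP => hp; last by rewrite iter_optD h3.
have e1 : eps i I1 s = 0 by lia.
have e2 : n = 0%N by lia.
by move: h3 h5; rewrite e1 e2 /= => -[->] [->].
Qed.

Lemma S_i_up x mu s r i (P : int) : rep x mu s r -> 0 <= P ->
  pwt mu i s r = P -> et a1 a2 i x = None ->
  [/\ eps i I1 s = 0, eps i I2 r <= P &
   exists2 x', S_i a1 a2 i x = Some x' &
     rep x' mu (iter `|P - eps i I2 r|%N (fop i I1) s) (emax i I2 r)].
Proof.
move=> h P0 hP /(et_none h)[h1 h2]; have e0 := eps_ge0 i I2 r.
split=> //; first by lia.
set n := `|P - eps i I2 r|%N; have hn : n%:Z = P - eps i I2 r by rewrite /n; lia.
have [|x1 h3 h4] := iter_ft_left (n := n) h h2; first by lia.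
have [||x2 h5 h6] := iter_ft_right (i := i) (n := `|eps i I2 r|%N) h4.
- by lia.
- by move: hP; rewrite /pwt eps_iter_fop wgt_iter_fop cartan_diag; lia.
exists x2; last by rewrite emax_iter.
rewrite /S_i (wt_rep h) hP P0.
have -> : `|P|%N = (`|eps i I2 r| + n)%N by lia.
by rewrite iter_optD h3.
Qed.

(** * Reflections of an extremal element *)

(* What lies behind the boundary once it has moved past [x_0, ..., x_(n-1)], read
   from the boundary on. *)
Fixpoint reflected (P : nat -> int) (x y : seq int) (n : nat) : seq int :=
  if n is n'.+1 then P n' - x`_n' :: reflected P x y n' else y.

Lemma nth_reflected P x y m k l :
  (reflected P x y (m + k))`_(m + l) = (reflected P x y k)`_l.
Proof. by elim: m. Qed.

Section Orbit.
Variables k1 k2 : nat.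
Local Notation ppair := (ppair a1 a2 k1 k2).
Local Notation qpair := (qpair a1 a2 k1 k2).
Hypothesis pp0 : forall n, 0 <= (ppair n).1 /\ 0 <= (ppair n).2.
Hypothesis qp0 : forall n, 0 <= (qpair n).1 /\ 0 <= (qpair n).2.

Lemma ppairS n : ppair n.+1 =
  ((ppair n).2, coef (letter I1 n) * (ppair n).2 - (ppair n).1).
Proof.
rewrite /=; case: (ppair n) => u v /=; congr (_, _ * _ - _).
by rewrite /coef /letter; case: (odd n) => /=; rewrite opprK.
Qed.

Lemma qpairS n : qpair n.+1 =
  (coef (letter I2 n) * (qpair n).1 - (qpair n).2, (qpair n).1).
Proof.
rewrite /=; case: (qpair n) => u v /=; congr (_ * _ - _, _).
by rewrite /coef /letter; case: (odd n) => /=; rewrite opprK.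
Qed.

Variables (X : elt) (mu : weight) (s r x y : seq int).
Hypothesis Xext : extremal a1 a2 X.
Hypothesis Xrep : rep X mu s r.
Hypothesis sx : is_string I1 I1 s x.
Hypothesis ry : is_string I2 I2 r y.
Hypothesis w1 : pwt mu I1 s r = - k1%:Z.
Hypothesis w2 : pwt mu I2 s r = k2%:Z.

(** A reflection strips the left factor in its direction, which deletes the head [x_n] of its
    string. It also applies [f] exactly [P n - x_n] times to a right factor with [eps] 0, which
    prepends this number to the string there. The inequality [x_n <= P n] says that this number is
    nonnegative. *)
Lemma orbit_down n : let P m := (ppair m).2 in let i := letter I1 n in
  exists w Y a b, [/\ S_w a1 a2 w X = Some Y, rep Y mu a b,
    is_string I1 i a (drop n x), is_string I2 (other i) b (reflected P x y n) &
    [/\ pwt mu i a b = - (ppair n).2, pwt mu (other i) a b = (ppair n).1 &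
    forall m, (m < n)%N -> x`_m <= P m]].
Proof.
elim: n => [|n IH] P i.
  by exists [::], X, s, r; rewrite drop0; split.
have [w [Y [a [b [h1 h2 h3 h4 [h5 h6 h7]]]]]] := IH.
set k := letter I1 n in h3 h4 h5 h6.
have [P1 P2] := pp0 n.
have [_ hft] := Xext k h1.
rewrite (wt_rep h2) h5 in hft.
have [|g1 g2 [Y' hY' h2']] := S_i_down h2 P2 h5; first by apply: hft; lia.
have [e1 h3'] := string_behead h3.
rewrite nth_drop addn0 in e1; rewrite e1 in g2 h2'.
set N := `|_|%N in h2'.
have hN : N%:Z = P n - x`_n by rewrite /N /P; lia.
exists (k :: w), Y', (emax k I1 a), (iter N (fop k I2) b).
have iE : i = other k by rewrite /i letterSr.
rewrite iE otherK; split=> //.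
- by rewrite /= h1.
- by rewrite -drop1 drop_drop add1n in h3'.
- rewrite /= eps_iter_fop g1 add0r hN; split=> //.
  by apply: is_string_teq h4; apply: esym; exact: emax_iter_fop.
have hw l : pwt mu l (emax k I1 a) (iter N (fop k I2) b) =
    pwt mu l a b + (ppair n).2 * cartan l k.
  rewrite /pwt wgt_emax wgt_iter_fop hN e1 /P; lia.
rewrite !hw h5 h6 cartan_diag ppairS /= -/k /coef; split; [lia | lia |].
by move=> m; rewrite ltnS leq_eqVlt => /orP[/eqP->|] //; exact: h7.
Qed.

Lemma orbit_up n : let P m := (qpair m).1 in let i := letter I2 n in
  exists w Y a b, [/\ S_w a1 a2 w X = Some Y, rep Y mu a b,
    is_string I2 i b (drop n y), is_string I1 (other i) a (reflected P y x n) &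
    [/\ pwt mu i a b = (qpair n).1, pwt mu (other i) a b = - (qpair n).2 &
    forall m, (m < n)%N -> y`_m <= P m]].
Proof.
elim: n => [|n IH] P i.
  by exists [::], X, s, r; rewrite drop0; split.
have [w [Y [a [b [h1 h2 h3 h4 [h5 h6 h7]]]]]] := IH.
set k := letter I2 n in h3 h4 h5 h6.
have [P1 P2] := qp0 n.
have [het _] := Xext k h1.
rewrite (wt_rep h2) h5 in het.
have [|g1 g2 [Y' hY' h2']] := S_i_up h2 P1 h5; first by apply: het; lia.
have [e1 h3'] := string_behead h3.
rewrite nth_drop addn0 in e1; rewrite e1 in g2 h2'.
set N := `|_|%N in h2'.
have hN : N%:Z = P n - y`_n by rewrite /N /P; lia.
exists (k :: w), Y', (iter N (fop k I1) a), (emax k I2 b).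
have iE : i = other k by rewrite /i letterSr.
rewrite iE otherK; split=> //.
- by rewrite /= h1.
- by rewrite -drop1 drop_drop add1n in h3'.
- rewrite /= eps_iter_fop g1 add0r hN; split=> //.
  by apply: is_string_teq h4; apply: esym; exact: emax_iter_fop.
have hw l : pwt mu l (iter N (fop k I1) a) (emax k I2 b) =
    pwt mu l a b - (qpair n).1 * cartan l k.
  rewrite /pwt wgt_emax wgt_iter_fop hN e1 /P; lia.
rewrite !hw h5 h6 cartan_diag qpairS /= -/k /coef; split; [lia | lia |].
by move=> m; rewrite ltnS leq_eqVlt => /orP[/eqP->|] //; exact: h7.
Qed.

Lemma reflected_down_cone n :
  cone (other (letter I1 n)) (reflected (fun m => (ppair m).2) x y n).
Proof. by have [w [Y [a [b [_ _ _ h _]]]]] := orbit_down n; exact: string_cone h. Qed.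

Lemma reflected_up_cone n :
  cone (other (letter I2 n)) (reflected (fun m => (qpair m).1) y x n).
Proof. by have [w [Y [a [b [_ _ _ h _]]]]] := orbit_up n; exact: string_cone h. Qed.

End Orbit.

(** * The limit of the cone inequalities *)

Definition growth (i : Idx) : R := if i is I1 then betaR a1 a2 else alphaR a1 a2.
Local Notation KR i n := (int2R (K i n)).

Section Reals.
Local Open Scope R_scope.

(** Divided by [growth (other i)], the last identity is the fixed point equation of the quotient
    recursion [coef - 1 / quotient] coming from [K]. *)
Lemma growth_spec i : 0 < growth i /\ 1 <= growth i * growth (other i) /\
  growth i * growth (other i) + 1 = int2R (coef i) * growth (other i).
Proof.
have h1 : 0 < INR a1 by apply: lt_0_INR; nia.
have h2 : 0 < INR a2 by apply: lt_0_INR; nia.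
have hP : 5 <= INR a1 * INR a2.
  have -> : 5 = INR 5 by rewrite /=; lra.
  by rewrite -mult_INR; apply: le_INR; lia.
set D := INR a1 ^ 2 * INR a2 ^ 2 - 4 * INR a1 * INR a2.
have hD : 0 <= D by rewrite /D; nra.
have q0 := sqrt_pos D; have qq := sqrt_sqrt _ hD.
have cE : int2R (coef i) = if i is I1 then INR a2 else INR a1.
  by rewrite /coef; case: (i) => /=; rewrite opprK.
set q := sqrt D in q0 qq; set P := INR a1 * INR a2 in hP.
have eA : alphaR a1 a2 = (P + q) / (2 * INR a2) by [].
have eB : betaR a1 a2 = (P + q) / (2 * INR a1) by [].
have hA : 0 < alphaR a1 a2 by rewrite eA; apply: Rdiv_lt_0_compat; lra.
have hB : 0 < betaR a1 a2 by rewrite eB; apply: Rdiv_lt_0_compat; lra.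
have a1B : INR a1 * betaR a1 a2 = (P + q) / 2 by rewrite eB; field; lra.
have a2A : INR a2 * alphaR a1 a2 = (P + q) / 2 by rewrite eA; field; lra.
have AB : alphaR a1 a2 * betaR a1 a2 = (P + q) / 2 - 1.
  (* Multiplied by [P], the identity only involves the two known products and the square of [q]. *)
  have e : P * (alphaR a1 a2 * betaR a1 a2) = P * ((P + q) / 2 - 1).
    have -> : P * (alphaR a1 a2 * betaR a1 a2) =
      (INR a2 * alphaR a1 a2) * (INR a1 * betaR a1 a2) by rewrite /P; ring.
    rewrite a1B a2A.
    have : q * q = P * P - 4 * P by rewrite qq /D /P; ring.
    by nra.
  by apply: Rmult_eq_reg_l e _; lra.
rewrite cE; case: i {cE} => /=; split=> //.
  by rewrite a2A Rmult_comm AB; lra.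
by rewrite a1B AB; lra.
Qed.

Lemma growth_gt0 i : 0 < growth i.
Proof. by case: (growth_spec i). Qed.

Lemma growth_rec i : growth i * growth (other i) + 1 = int2R (coef i) * growth (other i).
Proof. by case: (growth_spec i) => _ []. Qed.

(* The difference shrinks by the factor [growth i * growth (other i)] every
   second step, while [K] is unbounded, so the quotients of consecutive values
   of [K] tend to [growth]. *)
Lemma K_growth i m :
  let d := KR i m.+1 - growth i * KR (other i) m in
  0 <= d <= (if odd m then / growth (other i) else 1).
Proof.
elim: m i => [|m IH] i d.
  rewrite /d /=; lra.
have g1 := growth_gt0 i; have g2 := growth_gt0 (other i).
have := IH (other i); rewrite otherK; set d' := _ - _ => /= hd'.
have e : d = d' * / growth (other i).
  apply: (Rmult_eq_reg_r (growth (other i))); last by lra.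
  rewrite Rmult_assoc Rinv_l; last by lra.
  rewrite /d /d' KSS int2RB int2RM.
  transitivity (KR (other i) m.+1 * (int2R (coef i) * growth (other i))
    - KR i m * growth (other i) - growth i * growth (other i) * KR (other i) m.+1).
    by ring.
  by rewrite -growth_rec; ring.
have i2 : 0 < / growth (other i) by exact: Rinv_0_lt_compat.
rewrite e /=; split; first by nra.
case: (odd m) hd' => /= hd'; last by nra.
apply: (Rle_trans _ (/ growth i * / growth (other i))); first by nra.
rewrite -Rinv_mult -[X in _ <= X]Rinv_1; apply: Rinv_le_contravar; first by lra.
by case: (growth_spec i) => _ [].
Qed.

(** If [b] exceeded [growth i * a] by a gap [e], then [K (other i) m * e] would stay bounded by the
    bounded error of [K_growth] times [a], while [K] is unbounded. *)
Lemma cone_limit i (a b : int) (N : nat) : (0 <= a)%R ->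
  (forall m, (N <= m)%N -> (K (other i) m * b <= K i m.+1 * a)%R) ->
  int2R b <= growth i * int2R a.
Proof.
move=> a0 h; apply: Rnot_lt_le => hlt.
have a0' : 0 <= int2R a := int2R_le a0.
(* A bound for the error that serves both parities of [m]. *)
set M := 1 + / growth (other i).
have i2 : 0 < / growth (other i) by apply: Rinv_0_lt_compat; exact: growth_gt0.
set e := int2R b - growth i * int2R a.
have e0 : 0 < e by rewrite /e; lra.
have [n hn] := INR_unbounded (2 * (M * int2R a) / e).
have hn' : 2 * (M * int2R a) < INR n * e.
  have := Rmult_lt_compat_r _ _ _ e0 hn.
  by rewrite /Rdiv Rmult_assoc Rinv_l; lra.
pose m := maxn N n.
have := int2R_le (h m (leq_maxl _ _)); rewrite !int2RM.
have := K_growth i m; set d := _ - _ => -[d0 d1].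
have {}d1 : d <= M by rewrite /M; case: (odd m) d1; lra.
have := int2R_le (K_unbounded (other i) m); rewrite int2RM => hK.
have hK2 : INR n <= 2 * KR (other i) m.
  by apply: (Rle_trans _ (INR m)); [apply: le_INR; rewrite /m; lia | exact: hK].
have dK : KR i m.+1 = growth i * KR (other i) m + d by rewrite /d; ring.
rewrite dK => hh.
have h1 : KR (other i) m * e <= d * int2R a by rewrite /e; nra.
nra.
Qed.

End Reals.

(** After [m - l] more steps of the boundary, the entries at [l] and [l.+1] sit at [m] and [m.+1].
    The same two numbers thus satisfy the cone inequality for every [m >= l]. *)
Lemma reflected_growth j P x y : (forall n m, 0 <= (reflected P x y n)`_m) ->
  (forall n, cone (other (letter j n)) (reflected P x y n)) -> forall k l,
  Rle (int2R (reflected P x y k)`_l.+1)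
    (Rmult (growth (letter (other (letter j k)) l)) (int2R (reflected P x y k)`_l)).
Proof.
move=> h0 h k l; apply: (cone_limit (N := l)) => // m lm.
have := h (m - l + k)%N m.
have -> : letter (other (letter j (m - l + k))) m = letter (other (letter j k)) l.
  have /(congr1 odd) : (m = (m - l) + l)%N by lia.
  rewrite /letter !oddD; case: (odd (m - l)); case: (odd k); case: (odd l) => /= ->;
    by rewrite ?otherK.
have e2 : (m - l + l = m)%N by lia.
have := nth_reflected P x y (m - l) k l; have := nth_reflected P x y (m - l) k l.+1.
by rewrite addnS e2 => -> ->.
Qed.

(** * The polytope on bi-infinite sequences *)

Section Polytope.
Variables k1 k2 : nat.
Local Notation p := (Defs.p a1 a2 k1 k2).
Local Notation ppair := (ppair a1 a2 k1 k2).
Local Notation qpair := (qpair a1 a2 k1 k2).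

Definition zletter (k : int) : Idx := if odd `|k|%N then I1 else I2.

Lemma p_pos n : p (Posz n.+1) = (ppair n).2.
Proof. by rewrite /Defs.p ppairS. Qed.

Lemma p_neg n : p (- Posz n) = (qpair n).1.
Proof. by case: n. Qed.

Lemma zletter_pos n : zletter (Posz n.+1) = letter I1 n.
Proof. by rewrite /zletter /letter /=; case: (odd n). Qed.

Lemma zletter_neg n : zletter (- Posz n) = letter I2 n.
Proof. by rewrite /zletter /letter abszN /=; case: (odd n). Qed.

Lemma int_pos_neg (k : int) : (exists n, k = Posz n.+1) \/ (exists n, k = - Posz n).
Proof.
by case: k => [[|n]|n]; [right; exists 0%N | left; exists n | right; exists n.+1].
Qed.

Lemma p_rec (k : int) : p (k - 1) + p (k + 1) = coef (zletter k) * p k.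
Proof.
case: (int_pos_neg k) => -[n ->].
  have -> : Posz n.+1 - 1 = Posz n by lia.
  have -> : Posz n.+1 + 1 = Posz n.+2 by lia.
  rewrite zletter_pos !p_pos ppairS -[p (Posz n)]/(ppair n).1.
  by rewrite [(_, _).2]/=; lia.
have -> : - Posz n - 1 = - Posz n.+1 by lia.
rewrite zletter_neg !p_neg qpairS /=.
suff -> : p (- Posz n + 1) = (qpair n).2 by lia.
case: n => [//|n].
have -> : - Posz n.+1 + 1 = - Posz n by lia.
by rewrite p_neg qpairS.
Qed.

(** In these coordinates the forms on both sides of the boundary become uniform in [k]. The last two
    conditions are exchanged by replacing [U] with [p - U] and reversing the index. *)
Definition polytope (U : int -> int) : Prop := forall k,
  [/\ 0 <= U k, U k <= p k,
   Rle (int2R (U (k + 1))) (Rmult (growth (zletter k)) (int2R (U k))) &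
   Rle (int2R (p k - U k))
     (Rmult (growth (zletter (k + 1))) (int2R (p (k + 1) - U (k + 1))))].

Lemma zletterS (k : int) : zletter (k + 1) = other (zletter k).
Proof.
rewrite /zletter; have : odd (absz (k + 1)) = ~~ odd (absz k) by lia.
by move=> ->; case: (odd _).
Qed.

Lemma polytope_step (U U' : int -> int) k : polytope U ->
  (forall m, U' m = U m + (m == k)%:R) ->
  U (k - 2) + U k < coef (zletter (k - 1)) * U (k - 1) -> polytope U'.
Proof.
move=> H hU hk.
set c := coef _ in hk.
have hp : p (k - 2) + p k = c * p (k - 1).
  by rewrite -p_rec; congr (p _ + p _); lia.
have [u0 u1 u2 u3] := H (k - 2); have [v0 v1 v2 v3] := H (k - 1).
have [t0 t1 t2 t3] := H k.
have e1 : k - 2 + 1 = k - 1 by lia.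
have e2 : k - 1 + 1 = k by lia.
rewrite e1 in u2 u3; rewrite e2 in v2 v3.
have z1 : zletter k = other (zletter (k - 1)) by rewrite -zletterS e2.
have z2 : zletter (k - 2) = other (zletter (k - 1)).
  by rewrite -e1 zletterS otherK.
set i := zletter (k - 1) in z1 z2 c v2 u3 hp hk.
have g1 := growth_gt0 i; have g2 := growth_gt0 (other i).
have gr := growth_rec i; rewrite -/c in gr.
have hk1 : Rle (Rplus (int2R (U k)) 1)
    (Rminus (Rmult (int2R c) (int2R (U (k - 1)))) (int2R (U (k - 2)))).
  by rewrite -int2RM -int2RB -int2R1 -int2RD; apply: int2R_le; lia.
have hk2 : Rle (Rminus (Rmult (int2R c) (int2R (p (k - 1) - U (k - 1))))
    (int2R (p (k - 2) - U (k - 2)))) (Rminus (int2R (p k - U k)) 1).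
  by rewrite -int2RM -int2RB -int2R1 -int2RB; apply: int2R_le; nia.
have V0 : Rle 0 (int2R (p (k - 1) - U (k - 1))) by apply: (@int2R_le 0); lia.
(* Only two real inequalities get tighter, this one and [n2]. Here [hk1] is multiplied by
   [growth (other i)], rewritten with [growth_rec], and combined with the condition at [k - 2]. *)
have n1 : Rle (Rplus (int2R (U k)) 1) (Rmult (growth i) (int2R (U (k - 1)))).
  rewrite z2 in u2.
  apply: (Rmult_le_reg_l (growth (other i))) => //.
  set a := int2R (U k) in hk1 *; set b := int2R (U (k - 1)) in hk1 u2 *.
  set d := int2R (U (k - 2)) in hk1 u2.
  apply: Rle_trans (Rmult_le_compat_l _ _ _ (Rlt_le _ _ g2) hk1) _.
  have e : Rmult (growth (other i)) (Rminus (Rmult (int2R c) b) d) =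
      Rminus (Rmult (Rmult (int2R c) (growth (other i))) b) (Rmult (growth (other i)) d).
    by ring.
  by rewrite e -gr; lra.
have n2 : Rle (int2R (p (k - 1) - U (k - 1)))
    (Rmult (growth (other i)) (Rminus (int2R (p k - U k)) 1)).
  set a := int2R (p k - U k) in hk2 *; set b := int2R (p (k - 1) - U (k - 1)) in hk2 u3 *.
  set d := int2R (p (k - 2) - U (k - 2)) in hk2 u3.
  apply: Rle_trans (Rmult_le_compat_l _ _ _ (Rlt_le _ _ g2) hk2).
  have e : Rmult (growth (other i)) (Rminus (Rmult (int2R c) b) d) =
      Rminus (Rmult (Rmult (int2R c) (growth (other i))) b) (Rmult (growth (other i)) d).
    by ring.
  rewrite e -gr.
  have := Rmult_le_compat_l _ _ _ (Rlt_le _ _ g2) u3.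
  by lra.
(* The upper bound follows from [n2], whose left side is nonnegative. *)
have V1 : U k + 1 <= p k.
  have : 0 <= p k - U k - 1; last by lia.
  apply: int2R_ge0; rewrite int2RB /=.
  apply: (Rmult_le_reg_l (growth (other i))) => //.
  by rewrite Rmult_0_r; apply: Rle_trans V0 n2.
move=> m; rewrite !hU; have [w0 w1 w2 w3] := H m.
have [e|ne] := eqVneq m k.
  rewrite e in w0 w1 w2 w3 *; have -> : (k + 1 == k) = false by lia.
  rewrite mulr1n addr0 opprD addrA; split=> //; first by lia.
    rewrite int2RD int2R1; have := growth_gt0 (zletter k).
    by move: w2; nra.
  by rewrite (int2RB (p k - U k) 1) int2R1; lra.
have [e|ne2] := eqVneq (m + 1) k; last by rewrite !mulr0n !addr0.
have e' : m = k - 1 by lia.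
rewrite mulr0n mulr1n addr0 e e' z1 opprD addrA; split=> //.
  by rewrite int2RD.
by rewrite (int2RB (p k - U k) 1).
Qed.

(* The coordinates of the paper are [x_k = U k] for [k >= 1] and
   [x_k = U k - p k] for [k <= 0]. *)
Definition ucoord (s r : seq int) (k : int) : int :=
  match k with
  | Posz n.+1 => s`_n
  | Posz 0 => p k - r`_0
  | Negz n => p k - r`_n.+1
  end.

Lemma ucoord_neg s r n : ucoord s r (- Posz n) = p (- Posz n) - r`_n.
Proof. by case: n. Qed.

Hypothesis pp0 : forall n, 0 <= (ppair n).1 /\ 0 <= (ppair n).2.
Hypothesis qp0 : forall n, 0 <= (qpair n).1 /\ 0 <= (qpair n).2.

(** Moving the boundary into the left factor exhibits [p - U], read downwards, as a string; moving
    it into the right factor exhibits [U], read upwards. Reflected sequences continue with the other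
    component, so the pairs across the original boundary are covered too. *)
Lemma extremal_polytope X mu c d s r : extremal a1 a2 X -> rep X mu c d ->
  is_string I1 I1 c s -> is_string I2 I2 d r ->
  pwt mu I1 c d = - k1%:Z -> pwt mu I2 c d = k2%:Z -> polytope (ucoord s r).
Proof.
move=> hX hrep hs hr w1 w2.
have s0 n : 0 <= s`_n by apply: (cone_ge0 (j := I1)); apply: string_cone hs.
have r0 n : 0 <= r`_n by apply: (cone_ge0 (j := I2)); apply: string_cone hr.
have sP n : s`_n <= (ppair n).2.
  have [w [Y [a [b [_ _ _ _ [_ _]]]]]] := orbit_down pp0 hX hrep hs hr w1 w2 n.+1.
  by apply.
have rP n : r`_n <= (qpair n).1.
  have [w [Y [a [b [_ _ _ _ [_ _]]]]]] := orbit_up qp0 hX hrep hs hr w1 w2 n.+1.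
  by apply.
have down : forall k l, Rle (int2R (reflected (fun m => (ppair m).2) s r k)`_l.+1)
    (Rmult (growth (letter (other (letter I1 k)) l))
      (int2R (reflected (fun m => (ppair m).2) s r k)`_l)).
  apply: reflected_growth => [n m|n]; last first.
    exact: (reflected_down_cone pp0 hX hrep hs hr w1 w2).
  by elim: n m => [//|n IH] [|m] //=; rewrite subr_ge0.
have up : forall k l, Rle (int2R (reflected (fun m => (qpair m).1) r s k)`_l.+1)
    (Rmult (growth (letter (other (letter I2 k)) l))
      (int2R (reflected (fun m => (qpair m).1) r s k)`_l)).
  apply: reflected_growth => [n m|n]; last first.
    exact: (reflected_up_cone qp0 hX hrep hs hr w1 w2).
  by elim: n m => [//|n IH] [|m] //=; rewrite subr_ge0.
move=> k; case: (int_pos_neg k) => -[n ->].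
  have -> : Posz n.+1 + 1 = Posz n.+2 by lia.
  rewrite !zletter_pos !p_pos /ucoord; split=> //.
    exact: (up 0%N n).
  by have := down n.+2 0%N; rewrite /= !letterSr otherK.
rewrite ucoord_neg zletter_neg p_neg subKr; split=> //; first by have := rP n; lia.
- by have := r0 n; lia.
- case: n => [|n]; first exact: (up 1%N 0%N).
  have -> : - Posz n.+1 + 1 = - Posz n by lia.
  by rewrite ucoord_neg p_neg; have := up n.+2 0%N; rewrite /= !letterSr otherK.
case: n => [|n].
  exact: (down 1%N 0%N).
have -> : - Posz n.+1 + 1 = - Posz n by lia.
by rewrite ucoord_neg zletter_neg p_neg subKr; exact: (down 0%N n).
Qed.

Lemma wgtS i j (s : seq int) :
  wgt i j s = wgt i (other j) (drop 1 s) - s`_0 * cartan i j.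
Proof. by case: s => [|x s] //=; rewrite ?drop0 //; lia. Qed.

Lemma cartan_other i : cartan i (other i) = - coef (other i).
Proof. by rewrite /coef otherK opprK. Qed.

Lemma ucoord_fop i s r : polytope (ucoord s r) ->
  eps i I2 r - eps i I1 s < pwt (k1%:Z, - k2%:Z) i s r ->
  polytope (ucoord (fop i I1 s) r).
Proof.
move=> H h; have [n [hl hs hlt hn]] := fop_spec i I1 s.
apply: (polytope_step (k := Posz n.+1) H).
  move=> m; case: (int_pos_neg m) => -[l ->].
    by rewrite /ucoord hn eqz_nat eqSS.
  have -> : (- Posz l == Posz n.+1) = false by lia.
  by rewrite !ucoord_neg addr0.
(* For the first two positions the neighbour two places to the right lies in the other factor, and
   the tensor product rule supplies the strict comparison with it. *)
case: n hl hs hlt hn => [|[|n]] hl hs hlt _.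
- move: h; rewrite -hl -[letter _ _]/I1 in hs *; rewrite -hs => h.
  have h1 := eps_ge_sgm r (erefl : letter I2 1 = I1).
  have {hs hlt} h2 : sgm I1 r 1 - sgm I1 s 0 < pwt (k1%:Z, - k2%:Z) I1 s r by lia.
  move: h2; rewrite /sgm /pwt (wgtS I1 I1 s) (wgtS I1 I2 r).
  rewrite [other I2]/= (wgtS I1 I1 (drop 1 r)) drop_drop nth_drop.
  rewrite -[Posz 1 - 2]/(- Posz 1) -[Posz 1 - 1]/(- Posz 0).
  rewrite !ucoord_neg !p_neg zletter_neg /letter /coef /=.
  rewrite -[(1 + 1)%N]/2%N -[(1 + 0)%N]/1%N; nia.
- move: h; rewrite -hl -[letter _ _]/I2 in hs *; rewrite -hs => h.
  have h1 := eps_ge_sgm r (erefl : letter I2 0 = I2).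
  have {hs hlt} h2 : sgm I2 r 0 - sgm I2 s 1 < pwt (k1%:Z, - k2%:Z) I2 s r by lia.
  move: h2; rewrite /sgm /pwt (wgtS I2 I1 s) (wgtS I2 I2 r).
  rewrite [other I1]/= (wgtS I2 I2 (drop 1 s)) drop_drop nth_drop.
  rewrite -[Posz 2 - 2]/(- Posz 0) -[Posz 2 - 1]/(Posz 1).
  rewrite !ucoord_neg !p_neg zletter_pos /letter /coef /=.
  rewrite -[(1 + 1)%N]/2%N -[(1 + 0)%N]/1%N; nia.
have e : letter I1 n = i by rewrite -hl !letterSr otherK.
have := hlt n; rewrite ltnS leqnSn e => /(_ isT erefl).
have := sgm_step i s n; rewrite cartan_other hs.
have -> : Posz n.+3 - 2 = Posz n.+1 by lia.
have -> : Posz n.+3 - 1 = Posz n.+2 by lia.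
rewrite zletter_pos letterSr e /=; lia.
Qed.

(** Lowering [r_n] raises [U] at [- n]. The strict comparison with position [n.+2] is the inequality
    of [polytope_step], as the terms in [p] cancel by [p_rec]. *)
Lemma ucoord_eop i s r : polytope (ucoord s r) -> 0 < eps i I2 r ->
  polytope (ucoord s (eop i I2 r)).
Proof.
move=> H h; have [n [hl hs hlt hn]] := eop_spec h.
apply: (polytope_step (k := - Posz n) H).
  move=> m; case: (int_pos_neg m) => -[l ->].
    have -> : (Posz l.+1 == - Posz n) = false by lia.
    by rewrite addr0.
  by rewrite !ucoord_neg hn eqr_opp opprB addrA addrAC.
have e : letter I2 n.+2 = i by rewrite -hl !letterSr otherK.
have := hlt n.+2; rewrite ltnS leqnSn e => /(_ isT erefl).
have := sgm_step i r n; rewrite cartan_other hs.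
have -> : - Posz n - 2 = - Posz n.+2 by lia.
have hp := p_rec (- Posz n.+1).
have e1 : - Posz n.+1 - 1 = - Posz n.+2 by lia.
have e2 : - Posz n.+1 + 1 = - Posz n by lia.
have -> : - Posz n - 1 = - Posz n.+1 by lia.
rewrite e1 e2 in hp.
move: hp; rewrite !ucoord_neg zletter_neg letterSr hl; nia.
Qed.

(** What is retained of extremality along the path of operators [f_i]. The cone condition provides
    the nonnegativity needed for termination, and trimming lets a zero right factor be literally the
    empty list. *)
Definition invariant (x : elt) : Prop :=
  [/\ zmu x = (k1%:Z, - k2%:Z), ImP a1 a2 (zp x), trim (zm x) = zm x,
      cone I2 (opps (zm x)) & polytope (ucoord (zp x) (opps (zm x)))].

Lemma ucoord_teq s s' r r' : teq s s' -> teq r r' ->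
  polytope (ucoord s r) -> polytope (ucoord s' r').
Proof.
move=> /teqP hs /teqP hr H k.
have e m : ucoord s' r' m = ucoord s r m by case: m => [[|n]|n] /=; rewrite ?hs ?hr.
by rewrite !e; exact: H.
Qed.

Lemma ft_invariant i x x' : invariant x -> ft a1 a2 i x = Some x' -> invariant x'.
Proof.
case=> h1 [js h2] h3 h4 h5.
have xrep : rep x (zmu x) (zp x) (opps (zm x)) by split.
rewrite ftE; case: ifP => hlt; last case: ifP => // heps.
  case=> <-; split=> //=.
    by exists (rcons js i); rewrite foldl_rcons -h2 f_pE.
  apply: (ucoord_teq (esym (teq_trim _)) (erefl _)).
  by apply: ucoord_fop => //; rewrite -h1 -(wt_rep xrep).
case=> <-; split=> //=.
- by exists js.
- by rewrite trim_opps trimK.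
- by rewrite oppsK; apply: (cone_teq (esym (teq_trim _))); exact: cone_eop.
rewrite oppsK; apply: (ucoord_teq (erefl _) (esym (teq_trim _))).
exact: ucoord_eop.
Qed.

(** * Exhaustion of the right factor *)

Lemma f_word_cons i js x x' : ft a1 a2 i x = Some x' ->
  f_word a1 a2 (i :: js) x = f_word a1 a2 js x'.
Proof. by rewrite /f_word /= => ->. Qed.

Lemma f_word_cat js js' x x' : f_word a1 a2 js x = Some x' ->
  f_word a1 a2 (js ++ js') x = f_word a1 a2 js' x'.
Proof. by rewrite /f_word foldl_cat => ->. Qed.

Lemma sumz_teq s s' : teq s s' -> sumz s = sumz s'.
Proof.
suff H r : sumz (trim r) = sumz r by move=> h; rewrite -H h H.
elim: r => [//|x r IH]; rewrite trim_cons /= -/(sumz r) -IH.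
by case: ifP => [/andP[/eqP-> /eqP->]|].
Qed.

(* The left factor can absorb only finitely many [f_i] before the tensor product
   rule sends the next one to the right factor. *)
Lemma f_word_reduces i x : invariant x -> 0 < eps i I2 (opps (zm x)) ->
  exists js x', [/\ f_word a1 a2 js x = Some x', invariant x' &
    sumz (opps (zm x')) < sumz (opps (zm x))].
Proof.
(* The margin by which the rule selects the left factor; acting there lowers the weight by 2 and
   raises [eps] by 1, so [d] drops by 1. *)
pose d y := wt a1 a2 i y - (eps i I2 (opps (zm y)) - eps i I1 (zp y)).
have [n hn] : exists n : nat, d x <= n%:Z by exists `|d x|%N; lia.
elim: n x hn => [|n IH] x hn inv he;
  have [x' hx'] : exists x', ft a1 a2 i x = Some x'
    by rewrite ftE he; case: ifP => _; eexists.
  exists [:: i], x'; split=> //; first exact: ft_invariant hx'.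
  move: hx'; rewrite ftE he ltNge.
  have -> /= : wt a1 a2 i x <= eps i I2 (opps (zm x)) - eps i I1 (zp x).
    by move: hn; rewrite /d; lia.
  by case=> <- /=; rewrite oppsK (sumz_teq (teq_trim _)) sumz_eop //; lia.
have inv' := ft_invariant inv hx'.
move: (hx'); rewrite ftE he; case: ifP => hlt [e].
  have [||js [x'' [g1 g2 g3]]] := IH x' _ inv'.
  - rewrite -e; move: hn; rewrite /d /= !wtE /=.
    rewrite eps_trim wgt_trim eps_fop wgt_fop cartan_diag.
    by lia.
  - by rewrite -e.
  exists (i :: js), x''; split=> //; first by rewrite (f_word_cons _ hx').
  by move: g3; rewrite -e.
exists [:: i], x'; split=> //.
by rewrite -e /= oppsK (sumz_teq (teq_trim _)) sumz_eop //; lia.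
Qed.

(** As long as the right factor is nonzero some [eps] on it is positive by [eps_eq0_nil], and its
    sum can be lowered. *)
Lemma f_word_to_left x : invariant x ->
  exists js x', [/\ f_word a1 a2 js x = Some x', invariant x' & zm x' = [::]].
Proof.
have [n hn] : exists n : nat, sumz (opps (zm x)) < n%:Z.
  by exists `|sumz (opps (zm x))|.+1; lia.
elim: n x hn => [|n IH] x hn inv; have [_ _ htr hc _] := inv.
  by have := sumz_ge0 (fun m => cone_ge0 m hc); lia.
have [[i hi]|h] : (exists i, 0 < eps i I2 (opps (zm x))) \/
    forall i, eps i I2 (opps (zm x)) <= 0.
- case: (ltP 0 (eps I1 I2 (opps (zm x)))) => h1; first by left; exists I1.
  case: (ltP 0 (eps I2 I2 (opps (zm x)))) => h2; first by left; exists I2.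
  by right; case.
- have [js [x' [h1 h2 h3]]] := f_word_reduces inv hi.
  have [||js' [x'' [g1 g2 g3]]] := IH x' => //; first by lia.
  by exists (js ++ js'), x''; split=> //; rewrite (f_word_cat _ h1).
exists [::], x; split=> //.
have := eps_eq0_nil (fun m => cone_ge0 m hc) h.
by rewrite /teq trim_opps htr; case: (zm x).
Qed.

(** * From the polytope to the defining inequalities of Sigma *)

Lemma zetaE x k : zeta x k =
  ucoord (zp x) (opps (zm x)) k - (if (1 <= k)%R then 0 else p k).
Proof.
case: k => [[|n]|n]; rewrite /zeta /ucoord ?nth_opps.
- by rewrite /= opprK addrAC subrr add0r.
- by rewrite /= subr0.
- by rewrite /= opprK addrAC subrr add0r.
Qed.

Lemma invariant_Sigma x : invariant x -> Sigma a1 a2 k1 k2 (k1%:Z, - k2%:Z) x.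
Proof.
case=> h1 _ _ _ H.
pose U := ucoord (zp x) (opps (zm x)).
have zpos k : (1 <= k)%R -> zR x k = int2R (U k).
  by move=> h; rewrite /zR zetaE h subr0.
have zneg k : (k <= 0)%R -> zR x k = Rminus (int2R (U k)) (pR a1 a2 k1 k2 k).
  move=> h; rewrite /zR zetaE; have -> : (1 <= k)%R = false by lia.
  by rewrite int2RB.
have gE k : gam a1 a2 k = growth (zletter k).
  by rewrite /gam /growth /zletter; case: (odd _).
have Q k : [/\ Rle 0 (int2R (U k)), Rle (int2R (U k)) (pR a1 a2 k1 k2 k),
   Rle (int2R (U (k + 1))) (Rmult (gam a1 a2 k) (int2R (U k))) &
   Rle (Rminus (pR a1 a2 k1 k2 k) (int2R (U k)))
     (Rmult (gam a1 a2 (k + 1)) (Rminus (pR a1 a2 k1 k2 (k + 1)) (int2R (U (k + 1)))))].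
  have [u0 u1 u2 u3] := H k; split.
  - exact: (int2R_le u0).
  - exact: int2R_le.
  - by rewrite gE.
  - by move: u3; rewrite !int2RB gE.
split=> //; split; [|split; [|split]].
(* The two forms that mix [zeta_0] and [zeta_1] are the conditions at index 0. *)
- have [_ _ h _] := Q (Posz 0); rewrite zneg // zpos //.
  by rewrite -[Posz 0 + 1]/(Posz 1) in h; lra.
- have [_ _ _ h] := Q (Posz 0); rewrite zneg // zpos //.
  by rewrite -[Posz 0 + 1]/(Posz 1) in h; lra.
- move=> k hk; have hk2 : (1 <= k + 1)%R by lia.
  rewrite /succz !zpos //; have [u0 u1 u2 u3] := Q k.
  by split; [lra | split; lra].
(* For [k <= 0] the forms in [k - 1] and [k] are the conditions at index [k - 1]. *)
move=> k hk; have hk2 : (k - 1 <= 0)%R by lia.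
rewrite /predz !zneg //; have [u0 u1 _ _] := Q k; have [_ _ u2 u3] := Q (k - 1).
rewrite subrK in u2 u3.
by split; [lra | split; lra].
Qed.

End Polytope.

(** The components of the starred element are strings of those of [y]; by symmetry those of [y] are
    strings of the starred ones. The starred element has weight minus lambda, with pairings [- k1]
    and [k2]. *)
Lemma extremal_star_invariant k1 k2 y :
  (forall n, 0 <= (ppair a1 a2 k1 k2 n).1 /\ 0 <= (ppair a1 a2 k1 k2 n).2) ->
  (forall n, 0 <= (qpair a1 a2 k1 k2 n).1 /\ 0 <= (qpair a1 a2 k1 k2 n).2) ->
  ImPsi a1 a2 (k1%:Z, - k2%:Z) y -> extremal a1 a2 (star a1 a2 y) ->
  invariant k1 k2 y.
Proof.
move=> pp0 qp0 [h1 [h2 h3]] hext.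
have [htr hM] := ImM_cone h3; have hP := ImP_cone h2.
have [c hc ec] := star_pE hP; have [d hd ed] := star_mE hM.
split=> //; apply: (extremal_polytope pp0 qp0 hext (c := c) (d := d)).
- split; first by [].
    by rewrite /= ec; exact: teq_trim.
  by rewrite /= ed; exact: teq_trim.
- exact: is_string_sym.
- exact: is_string_sym.
- rewrite /pwt (wgt_string _ hc) (wgt_string _ hd) /= h1 /= wtc_m (wtcE iplusE); lia.
- rewrite /pwt (wgt_string _ hc) (wgt_string _ hd) /= h1 /= wtc_m (wtcE iplusE); lia.
Qed.

End Crystal.

(** * Nonnegativity of the integers p *)

Section Positivity.
Variables a1 a2 k1 k2 : nat.
Hypothesis adm : admissible a1 a2 k1 k2.

Lemma ppair_ge0 n : 0 <= (ppair a1 a2 k1 k2 n).1 /\ 0 <= (ppair a1 a2 k1 k2 n).2.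
Proof.
case: adm => [a1p [a2p [a12 [k1p [k2p [hge2 [ha1 ha2]]]]]]].
(* The induction starts at the pair of [p_1] and [p_2], since [p_0] may exceed [p_1]. *)
case: n => [|n]; first by split.
have [e|ne1] := eqVneq a1 1%N.
  have [h1 h2] := ha1 e.
  have ek : ((a2 - 2) * k1 + 2 * k1 = a2 * k1)%N by nia.
  (* With a coefficient 1 the sequence need not increase. The invariant alternates instead: one step
     at least doubles, the next at most halves. *)
  suff: let q := ppair a1 a2 k1 k2 n.+1 in
      if odd n then [/\ 0 <= q.1, 0 <= q.2 & q.1 <= 2 * q.2]
      else 0 <= q.1 /\ 2 * q.1 <= q.2.
    by case: (odd n) => -[] //; lia.
  elim: n => [|n IH]; first by rewrite /= ?e; split => //; lia.
  move: IH; rewrite (ppairS _ _ _ _ n.+1); case: (ppair a1 a2 k1 k2 n.+1) => u v /=.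
  rewrite /letter /coef /=; case: (odd n) => /= -[]; last by rewrite ?e; split; lia.
  by move=> ? ? ?; split; nia.
have [e|ne2] := eqVneq a2 1%N.
  have [h1 h2] := ha2 e.
  have ek : ((a1 - 2) * k2 + 2 * k2 = a1 * k2)%N by nia.
  suff: let q := ppair a1 a2 k1 k2 n.+1 in
      if odd n then 0 <= q.1 /\ 2 * q.1 <= q.2
      else [/\ 0 <= q.1, 0 <= q.2 & q.1 <= 2 * q.2].
    by case: (odd n) => -[] //; lia.
  elim: n => [|n IH]; first by rewrite /= ?e; split => //; lia.
  move: IH; rewrite (ppairS _ _ _ _ n.+1); case: (ppair a1 a2 k1 k2 n.+1) => u v /=.
  rewrite /letter /coef /=; case: (odd n) => /= -[]; first by rewrite ?e; split; lia.
  by move=> ? ? ?; split; nia.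
have [||h|h] := hge2; [lia | lia | |];
  (suff: 0 <= (ppair a1 a2 k1 k2 n.+1).1 <= (ppair a1 a2 k1 k2 n.+1).2 by lia);
  (elim: n => [|n IH]; first by rewrite /=; nia);
  (move: IH; rewrite (ppairS _ _ _ _ n.+1); case: (ppair a1 a2 k1 k2 n.+1) => u v /=);
  by rewrite /letter /coef /=; case: (odd n) => /=; nia.
Qed.

(** The same argument towards negative indices, where the other bounds of [admissible] start the
    induction. *)
Lemma qpair_ge0 n : 0 <= (qpair a1 a2 k1 k2 n).1 /\ 0 <= (qpair a1 a2 k1 k2 n).2.
Proof.
case: adm => [a1p [a2p [a12 [k1p [k2p [hge2 [ha1 ha2]]]]]]].
case: n => [|n]; first by split.
have [e|ne1] := eqVneq a1 1%N.
  have [h1 h2] := ha1 e.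
  have ek : ((a2 - 2) * k1 + 2 * k1 = a2 * k1)%N by nia.
  suff: let q := qpair a1 a2 k1 k2 n.+1 in
      if odd n then 0 <= q.2 /\ 2 * q.2 <= q.1
      else [/\ 0 <= q.2, 0 <= q.1 & q.2 <= 2 * q.1].
    by case: (odd n) => -[] //; lia.
  elim: n => [|n IH]; first by rewrite /= ?e; split => //; lia.
  move: IH; rewrite (qpairS _ _ _ _ n.+1); case: (qpair a1 a2 k1 k2 n.+1) => u v /=.
  rewrite /letter /coef /=; case: (odd n) => /= -[]; first by rewrite ?e; split; lia.
  by move=> ? ? ?; split; nia.
have [e|ne2] := eqVneq a2 1%N.
  have [h1 h2] := ha2 e.
  have ek : ((a1 - 2) * k2 + 2 * k2 = a1 * k2)%N by nia.
  suff: let q := qpair a1 a2 k1 k2 n.+1 in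
      if odd n then [/\ 0 <= q.2, 0 <= q.1 & q.2 <= 2 * q.1]
      else 0 <= q.2 /\ 2 * q.2 <= q.1.
    by case: (odd n) => -[] //; lia.
  elim: n => [|n IH]; first by rewrite /= ?e; split => //; lia.
  move: IH; rewrite (qpairS _ _ _ _ n.+1); case: (qpair a1 a2 k1 k2 n.+1) => u v /=.
  rewrite /letter /coef /=; case: (odd n) => /= -[]; last by rewrite ?e; split; lia.
  by move=> ? ? ?; split; nia.
have [||h|h] := hge2; [lia | lia | |];
  (suff: 0 <= (qpair a1 a2 k1 k2 n.+1).2 <= (qpair a1 a2 k1 k2 n.+1).1 by lia);
  (elim: n => [|n IH]; first by rewrite /=; nia);
  (move: IH; rewrite (qpairS _ _ _ _ n.+1); case: (qpair a1 a2 k1 k2 n.+1) => u v /=);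
  by rewrite /letter /coef /=; case: (odd n) => /=; nia.
Qed.

End Positivity.

Theorem theorem3p4 (a1 a2 k1 k2 : nat) :
  admissible a1 a2 k1 k2 ->
  forall y : elt,
    ImPsi a1 a2 (Posz k1, - Posz k2)%R y ->
    extremal a1 a2 (star a1 a2 y) ->
    exists (js : seq Idx) (x : elt),
      Sigma' a1 a2 k1 k2 (Posz k1, - Posz k2)%R x /\
      f_word a1 a2 js y = Some x.
Proof.
move=> adm y hy hext; have [_ [_ [a12 _]]] := adm.
have inv := extremal_star_invariant a12 (ppair_ge0 adm) (qpair_ge0 adm) hy hext.
have [js [x [h1 h2 h3]]] := f_word_to_left a12 inv.
exists js, x; split=> //; split; first exact: (invariant_Sigma a12).
by split=> //; case: h2.
Qed.
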